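(* Let $C$ be a reduced curve in $\mathbb{P}^2$ (over $\mathbb{C}$). (i) If $C$ is a free curve and $Q$ is a (reduced) conic intersecting $C$ in a finite number of points, then the union $C'=C\cup Q$ is a curve of type at most $2$. (ii) If $C$ is a plus-one generated curve and $L$ is a line which is not an irreducible component of $C$, then the union $C'=C\cup L$ is a curve of type at most $2$.
   Context: Let $S=\mathbb{C}[x,y,z]$ with its standard grading. For a reduced curve $C:f=0$ of degree $d$ in $\mathbb{P}^2=\mathbb{P}^2_{\mathbb{C}}$, let $$D_0(f)=\{(a,b,c)\in S^3 : af_x+bf_y+cf_z=0\}$$ be the graded $S$-module of Jacobian syzygies, where a homogeneous element $(a,b,c)$ has degree $k$ if $a,b,c$ are homogeneous of degree $k$. Let $d_1\leq d_2\leq\dots\leq d_m$ be the degrees of the elements of a minimal system of homogeneous generators of $D_0(f)$. The type of $C$ is the integer $t(C)=d_1+d_2+1-d$. The curve $C$ is free if $D_0(f)$ is a free $S$-module, equivalently $d_1+d_2=d-1$, i.e. $t(C)=0$. The curve $C$ is plus-one generated if and only if $d_1+d_2=d$, i.e. $t(C)=1$. *)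

(* Defs.v *)
From HB Require Import structures.
From mathcomp Require Import all_boot all_order all_algebra.
From mathcomp Require Import reals.
From mathcomp Require Import complex.
From mathcomp Require Import mpoly.

Set Implicit Arguments.
Unset Strict Implicit.
Unset Printing Implicit Defensive.

Import Order.TTheory GRing.Theory Num.Theory.

Local Open Scope ring_scope.

(* R is a complete archimedean ordered field, so that R[i] is the field of      *)
(* complex numbers and {mpoly R[i][3]} is the ring S = CC[x, y, z].             *)

Definition mdvd (R : realType) (g f : {mpoly R[i][3]}) : Prop :=
  exists h, f = g * h.

(* [msize g] is one more than the total degree of g (and 0 when g = 0), so      *)
(* [(msize g <= 1)%N] says that g is constant.                                  *)
Definition squarefree (R : realType) (f : {mpoly R[i][3]}) : Prop :=
  forall g, mdvd (g ^+ 2) f -> (msize g <= 1)%N.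

Definition irreducible_mpoly (R : realType) (g : {mpoly R[i][3]}) : Prop :=
  (1 < msize g)%N /\
  forall a b, g = a * b -> (msize a <= 1)%N \/ (msize b <= 1)%N.

(* f = 0 is a reduced curve of degree d in the projective plane.                *)
Definition reduced_curve (R : realType) (d : nat) (f : {mpoly R[i][3]}) : Prop :=
  [/\ (0 < d)%N, f != 0, f \is d.-homog & squarefree f].

Definition line (R : realType) (l : {mpoly R[i][3]}) : Prop :=
  l != 0 /\ l \is 1.-homog.

(* The curve g = 0 is an irreducible component of the curve f = 0.              *)
Definition irreducible_component (R : realType) (g f : {mpoly R[i][3]}) : Prop :=
  irreducible_mpoly g /\ mdvd g f.

(* Points of the projective plane are given by nonzero vectors up to scaling:   *)
(* the list s contains a representative of every common point of f = g = 0.     *)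
Definition finite_intersection (R : realType) (f g : {mpoly R[i][3]}) : Prop :=
  exists s : seq 'rV[R[i]]_3,
    forall v : 'rV[R[i]]_3, v != 0 -> f.@[v 0] = 0 -> g.@[v 0] = 0 ->
      exists2 w, w \in s & exists c : R[i], v = c *: w.

(* The module D_0(f) of Jacobian syzygies, as a predicate on S^3.               *)
Definition D0 (R : realType) (f : {mpoly R[i][3]})
    (r : 'rV[{mpoly R[i][3]}]_3) : Prop :=
  \sum_(i < 3) r 0 i * f^`M(i) = 0.

Definition homog_vec (R : realType) (k : nat)
    (r : 'rV[{mpoly R[i][3]}]_3) : Prop :=
  forall i, r 0 i \is k.-homog.

(* The elements r j, for j in A, belong to D_0(f) and generate it over S.       *)
Definition generates_D0 (R : realType) (f : {mpoly R[i][3]}) (m : nat)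
    (r : 'I_m -> 'rV[{mpoly R[i][3]}]_3) (A : {set 'I_m}) : Prop :=
  (forall j, j \in A -> D0 f (r j)) /\
  forall u, D0 f u ->
    exists c : 'I_m -> {mpoly R[i][3]}, u = \sum_(j in A) c j *: r j.

Definition lin_indep (R : realType) (m : nat)
    (r : 'I_m -> 'rV[{mpoly R[i][3]}]_3) : Prop :=
  forall c : 'I_m -> {mpoly R[i][3]},
    \sum_j c j *: r j = 0 -> forall j, c j = 0.

(* D_0(f) is a free S-module. Any linearly independent family in S^3 is finite, *)
(* so only finite bases have to be considered; they need not be homogeneous.    *)
Definition free_curve (R : realType) (f : {mpoly R[i][3]}) : Prop :=
  exists (m : nat) (r : 'I_m -> 'rV[{mpoly R[i][3]}]_3),
    generates_D0 f r [set: 'I_m] /\ lin_indep r.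

(* r is a minimal system of homogeneous generators of D_0(f), with degrees e.   *)
(* Minimality excludes r j = 0, so that e j is determined by r j.               *)
Definition minimal_generators (R : realType) (f : {mpoly R[i][3]}) (m : nat)
    (r : 'I_m -> 'rV[{mpoly R[i][3]}]_3) (e : 'I_m -> nat) : Prop :=
  [/\ forall j, homog_vec (e j) (r j),
      generates_D0 f r [set: 'I_m]
    & forall A : {set 'I_m}, generates_D0 f r A -> A = [set: 'I_m]].

(* The curve f = 0 of degree d has type t: if e_0 <= e_1 <= ... are the degrees *)
(* of a minimal system of homogeneous generators, then t = e_0 + e_1 + 1 - d.   *)
(* At least two generators are needed since D_0(f) has rank at least two.       *)
Definition has_type (R : realType) (d : nat) (f : {mpoly R[i][3]})
    (t : int) : Prop :=
  exists (m : nat) (r : 'I_m.+2 -> 'rV[{mpoly R[i][3]}]_3) (e : 'I_m.+2 -> nat),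
    [/\ minimal_generators f r e,
        forall j k : 'I_m.+2, (j <= k)%N -> (e j <= e k)%N
      & t = (e (inord 0) + e (inord 1) + 1)%N%:Z - d%:Z].

Definition plus_one_generated (R : realType) (d : nat)
    (f : {mpoly R[i][3]}) : Prop :=
  has_type d f 1.

(* The type does not depend on the minimal system of generators; this           *)
(* formulation asserts that it exists and bounds it without presupposing that.  *)
Definition type_at_most (R : realType) (d : nat) (f : {mpoly R[i][3]})
    (k : int) : Prop :=
  (exists t, has_type d f t) /\ (forall t, has_type d f t -> t <= k).

(* Main.v *)
Require Import Defs.
From mathcomp Require Import all_boot all_order all_algebra.
From mathcomp Require Import ring zify boolp.
From mathcomp Require Import reals complex mpoly.

(** The type of a curve is bounded by the degrees of any two independent
    homogeneous Jacobian syzygies: the first two degrees [e_0 <= e_1] of a minimal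
    system of generators satisfy [e_0 + e_1 <= k + l] as soon as there are
    independent syzygies of degrees [k] and [l] ([first_degrees_le]), for they
    cannot both be multiples of the first generator.

    Syzygies pass from [f] to [f * g] at the price of the degree [e] of [g]. If the
    derivation [u] kills [f], then [g u] maps [f * g] to a multiple of [f * g], and
    subtracting a multiple of the Euler derivation gives a syzygy of [f * g]
    ([union_syzygy]); independence is preserved, since it is detected by the
    determinant with the Euler vector ([union_cross_neq0]). So a curve of degree [d]
    with independent syzygies of degrees [k] and [l] gives a union of type at most
    [k + l + 1 - d + e]. With [k + l = d - 1] and [e = 2] for a free curve and a
    conic, and with [k + l = d] and [e = 1] for a plus-one generated curve and a
    line, the bound is [2].

    It remains to find syzygies of these degrees. For a plus-one generated curve
    they are the first two generators, which are independent because the first one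
    is a primitive vector ([first_generators_independent]). For a free curve, Saito's
    criterion ([saito_criterion]) says that the cross product of a basis is a nonzero
    scalar multiple of the gradient, which is homogeneous of degree [d - 1]; hence
    homogeneous components of the two basis elements, of degrees adding up to
    [d - 1], are independent ([cross_components]).

    These arguments, and the fact that the union is again reduced, rest on unique
    factorisation in polynomial rings ([ufd_mpoly]), obtained from Gauss's lemma.
    For the conic, a common factor of [f] and [q] would be a form vanishing
    somewhere on every projective line, in particular on a line that avoids the
    finitely many points of the intersection ([common_zero_avoiding]). Finally, that
    the union has a type at all, that is, a finite minimal system of homogeneous
    generators, is Hilbert's basis theorem, derived from Dickson's lemma
    ([graded_hilbert_basis]). *)

Set Implicit Arguments.
Unset Strict Implicit.
Unset Printing Implicit Defensive.

Import Order.TTheory GRing.Theory Num.Theory.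

Local Open Scope ring_scope.

(** * Unique factorisation *)

Definition divides (A : comNzRingType) (x y : A) : Prop := exists c, y = x * c.

Definition prime_elt (A : idomainType) (p : A) : Prop :=
  [/\ p != 0, p \isn't a GRing.unit
    & forall a b, divides p (a * b) -> divides p a \/ divides p b].

Definition factored (A : idomainType) (x : A) : Prop :=
  exists (u : A) (s : seq A),
    [/\ u \is a GRing.unit, {in s, forall p, prime_elt p}
      & x = u * \prod_(p <- s) p].

Definition ufd (A : idomainType) : Prop := forall x : A, x != 0 -> factored x.

Lemma divides_mulr (A : comNzRingType) (x y z : A) :
  divides x y -> divides x (y * z).
Proof. by case=> c ->; exists (c * z); rewrite mulrA. Qed.

Lemma divides_mull (A : comNzRingType) (x y z : A) :
  divides x y -> divides x (z * y).
Proof. by rewrite mulrC; apply: divides_mulr. Qed.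

Lemma prime_ndivides_unit (A : idomainType) (p u : A) :
  prime_elt p -> u \is a GRing.unit -> ~ divides p u.
Proof.
case=> _ Np _ Uu [c uE]; case/negP: Np.
by move: Uu; rewrite uE unitrM => /andP[].
Qed.

Lemma prime_divides_prime (A : idomainType) (p q : A) :
  prime_elt p -> prime_elt q -> divides p q -> exists2 v, v \is a GRing.unit & q = p * v.
Proof.
move=> [p0 Np _] [q0 Nq Hq] [v qE]; exists v => //.
have [[w pE]|[w vE]] : divides q p \/ divides q v.
- by apply: Hq; rewrite -qE; exists 1; rewrite mulr1.
- have : p * (v * w) = p * 1 by rewrite mulr1 mulrA -qE -pE.
  by move/(mulfI p0)=> vw; apply/unitrP; exists w; rewrite [w * v]mulrC.
- case/negP: Np; apply/unitrP; exists w.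
  have : q * (p * w) = q * 1 by rewrite mulr1 mulrCA -vE -qE.
  by move/(mulfI q0)=> pw; rewrite [w * p]mulrC.
Qed.

(** The number of prime factors is the measure that makes the extraction of
    constant prime factors from a polynomial terminate, so it has to drop when a
    prime is cancelled. *)
Lemma prime_cofactor (A : idomainType) (p y u : A) (s : seq A) :
    prime_elt p -> u \is a GRing.unit -> {in s, forall q, prime_elt q} ->
    p * y = u * \prod_(q <- s) q ->
  exists (u' : A) (s' : seq A),
    [/\ u' \is a GRing.unit, {in s', forall q, prime_elt q},
        (size s' < size s)%N & y = u' * \prod_(q <- s') q].
Proof.
move=> pP Uu; elim: s y => [|q s IH] y sP.
  by rewrite big_nil mulr1 => e; case: (prime_ndivides_unit pP Uu); exists y.
rewrite big_cons => e; have qP : prime_elt q by apply: sP; rewrite mem_head.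
have sP' : {in s, forall q, prime_elt q} by move=> r rs; apply: sP; rewrite inE rs orbT.
have q0 : q != 0 by case: qP.
have p0 : p != 0 by case: pP.
case: (pP) => _ _ Hp; have := e; rewrite mulrCA => e'.
have [|qd|[z zE]] := Hp q (u * \prod_(j <- s) j).
- by exists y; rewrite e'.
- have [v Uv qE] := prime_divides_prime pP qP qd.
  exists (u * v), s; split=> //; first by rewrite unitrM Uu.
  by apply: (mulfI p0); rewrite e' qE; rewrite -!mulrA [v * _]mulrCA.
- have [u' [s' [Uu' sP'' lt yE]]] := IH z sP' (esym zE).
  exists u', (q :: s'); split=> //.
    by move=> r; rewrite inE => /predU1P[->|/sP''].
  by rewrite big_cons; apply: (mulfI p0); rewrite e' zE yE [u' * (q * _)]mulrCA [p * (q * _)]mulrCA.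
Qed.

Lemma ufd_prime_divisor (A : idomainType) (x : A) :
  ufd A -> x != 0 -> x \isn't a GRing.unit ->
  exists2 p, prime_elt p & divides p x.
Proof.
move=> HA x0 Nx; have [u [[|p s] [Uu sP xE]]] := HA x x0.
  by case/negP: Nx; rewrite xE big_nil mulr1.
exists p; first by apply: sP; rewrite mem_head.
by exists (u * \prod_(q <- s) q); rewrite xE big_cons mulrCA.
Qed.

(** The primes of [a] divide every [b * x i], hence divide [b] because [x] is
    primitive, and can be cancelled one after the other. This is the form in
    which unique factorisation enters the geometry: a vector whose entries have
    no common prime factor generates all the vectors proportional to it. *)
Lemma primitive_divides (A : idomainType) (I : Type) (x y : I -> A) (a b : A) :
    ufd A -> (forall p, prime_elt p -> ~ forall i, divides p (x i)) ->
    a != 0 -> (forall i, a * y i = b * x i) ->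
  exists h, forall i, y i = h * x i.
Proof.
move=> HA xP a0; have [u [s [Uu sP ->]]] := HA a a0.
elim: s sP b {a a0} => [|p s IH] sP b e.
  exists (u^-1 * b) => i; apply: (mulrI Uu); rewrite -!mulrA mulVKr // -e.
  by rewrite big_nil mulr1.
have pP : prime_elt p by apply: sP; rewrite mem_head.
have [p0 _ Hp] := pP.
have e' i : p * (u * (\prod_(q <- s) q) * y i) = b * x i.
  by rewrite -e big_cons [u * (p * _)]mulrCA !mulrA.
have sP' : {in s, forall q, prime_elt q}.
  by move=> r rs; apply: sP; rewrite inE rs orbT.
suff [c bE] : divides p b.
  apply: (IH sP' c) => i; apply: (mulfI p0).
  by rewrite e' bE !mulrA.
apply: contrapT => Nb; apply: (xP p pP) => i.
have [||//] := Hp b (x i) => //.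
by exists (u * (\prod_(q <- s) q) * y i); rewrite e'.
Qed.

Lemma factored_unit (A : idomainType) (u : A) :
  u \is a GRing.unit -> factored u.
Proof. by move=> Uu; exists u, [::]; rewrite big_nil mulr1. Qed.

Lemma factored_prime (A : idomainType) (p : A) : prime_elt p -> factored p.
Proof.
move=> pP; exists 1, [:: p]; rewrite unitr1 big_seq1 mul1r; split=> // q.
by rewrite inE => /eqP->.
Qed.

Lemma factoredM (A : idomainType) (x y : A) :
  factored x -> factored y -> factored (x * y).
Proof.
move=> [u [s [Uu sP ->]]] [v [t [Uv tP ->]]].
exists (u * v), (s ++ t); rewrite unitrM Uu big_cat mulrACA; split=> // p.
by rewrite mem_cat => /orP[/sP|/tP].
Qed.

Lemma divides_polyC (A : idomainType) (p : A) (P : {poly A}) :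
  (forall i, divides p P`_i) -> divides p%:P P.
Proof.
move=> /choice[c cE]; exists (\poly_(i < size P) c i); apply/polyP=> i.
rewrite coefCM coef_poly; case: ltnP => [_|le]; first exact: cE.
by rewrite mulr0 nth_default.
Qed.

(** The first coefficients of two polynomials that escape the prime [p] give,
    by multiplication, a coefficient of the product that escapes it too. *)
Lemma prime_polyC (A : idomainType) (p : A) : prime_elt p -> prime_elt p%:P.
Proof.
move=> [p0 Np Hp]; split=> [|| F G [H FG]].
- by rewrite polyC_eq0.
- by rewrite poly_unitE size_polyC p0 coefC.
apply: contrapT => /not_orP[NF NG].
have first_bad (P : {poly A}) : ~ divides p%:P P ->
    exists i, ~ divides p P`_i /\ forall j, (j < i)%N -> divides p P`_j.
  move=> NP; have bad : exists i, `[< ~ divides p P`_i >].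
    apply: contrapT => H0; apply/NP/divides_polyC => i; apply: contrapT => Hi.
    by apply: H0; exists i; apply/asboolP.
  case: (ex_minnP bad) => i /asboolP Hi min.
  exists i; split=> // j; rewrite ltnNge => /negP ji; apply: contrapT => Hj.
  by apply/ji/min/asboolP.
have [i [Fi Fm]] := first_bad F NF; have [j [Gj Gm]] := first_bad G NG.
have : divides p (F`_i * G`_j).
  have : divides p (F * G)`_(i + j) by exists H`_(i + j); rewrite FG coefCM.
  have lt : (i < (i + j).+1)%N by rewrite ltnS leq_addr.
  rewrite coefM (bigD1 (Ordinal lt)) //= addKn => -[c cE].
  suff [e eE] : divides p (\sum_(k < (i + j).+1 | k != Ordinal lt)
                              F`_k * G`_(i + j - k)).
    by exists (c - e); rewrite mulrBr -cE -eE addrK.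
  apply: (big_ind (divides p)) => [|x y [a ->] [b ->]|k nk].
  + by exists 0; rewrite mulr0.
  + by exists (a + b); rewrite mulrDr.
  have [ki|ik] := ltnP k i; first exact/divides_mulr/Fm.
  apply/divides_mull/Gm; rewrite ltn_subLR; last by rewrite -ltnS.
  rewrite ltn_add2r ltn_neqAle ik andbT eq_sym.
  by apply: contra nk => /eqP ki; apply/eqP/val_inj.
by case/Hp.
Qed.

Definition primitive_poly (A : idomainType) (P : {poly A}) : Prop :=
  forall p : A, prime_elt p -> ~ divides p%:P P.

(** A prime of [c] divides [P * G] but not the primitive polynomial [P], so it
    divides [G] and can be cancelled. *)
Lemma gauss_cancel (A : idomainType) (P F G : {poly A}) (c : A) :
    ufd A -> primitive_poly P -> c != 0 -> c%:P * F = P * G ->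
  divides P F.
Proof.
move=> HA PP c0; have [u [s [Uu sP ->]]] := HA c c0.
elim: s sP G {c c0} => [|p s IH] sP G.
  rewrite big_nil mulr1 => e; exists ((u^-1)%:P * G).
  by rewrite mulrCA -e mulrA -polyCM mulVr ?mul1r.
rewrite big_cons mulrCA polyCM -mulrA => e.
have pP : prime_elt p by apply: sP; rewrite mem_head.
have [p0 _ Hp] := prime_polyC pP.
have [|/(PP _ pP)//|[H GE]] := Hp P G; first by exists ((u * \prod_(j <- s) j)%:P * F).
apply: (IH _ H) => [q qs|]; first by apply: sP; rewrite inE qs orbT.
by apply: (mulfI p0); rewrite e GE mulrCA.
Qed.

Lemma gauss_split (A : idomainType) (P F G : {poly A}) (c : A) :
    ufd A -> c != 0 -> c%:P * P = F * G ->
  exists F' G', P = F' * G' /\ size G' = size G.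
Proof.
move=> HA c0; have [u [s [Uu sP ->]]] := HA c c0.
elim: s sP F G {c c0} => [|p s IH] sP F G.
  rewrite big_nil mulr1 => e; exists ((u^-1)%:P * F), G; split=> //.
  by rewrite -mulrA -e mulrA -polyCM mulVr ?mul1r.
rewrite big_cons mulrCA polyCM -mulrA => e.
have pP : prime_elt p by apply: sP; rewrite mem_head.
have sP' : {in s, forall q, prime_elt q} by move=> q qs; apply: sP; rewrite inE qs orbT.
have [p0 _ Hp] := prime_polyC pP.
have [|[H FE]|[H GE]] := Hp F G; first by exists ((u * \prod_(j <- s) j)%:P * P).
- by apply: (IH sP' H); apply: (mulfI p0); rewrite e FE mulrA.
have -> : size G = size H.
  by rewrite GE mul_polyC size_scale //; case: pP.
by apply: (IH sP' F H); apply: (mulfI p0); rewrite e GE mulrCA.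
Qed.

(** Gauss's lemma. Over the field of fractions [P] stays irreducible by
    [gauss_split], so it is prime there, and [gauss_cancel] brings divisibility
    by [P] back to polynomials over [A]. *)
Lemma gauss_prime (A : idomainType) (P : {poly A}) :
    ufd A -> primitive_poly P -> (1 < size P)%N ->
    (forall F G, P = F * G -> F \is a GRing.unit \/ G \is a GRing.unit) ->
  prime_elt P.
Proof.
move=> HA PP sP irr; have P0 : P != 0 by rewrite -size_poly_gt0 ltnW.
(* The relation [%|] is divisibility over the field of fractions. *)
have back F : P %| F -> divides P F.
  case/Pdiv.WeakIdomain.dvdpP=> -[c G] /= c0 e.
  by apply: (gauss_cancel (G := G) HA PP c0); rewrite mul_polyC e mulrC.
split=> // [|F G [H FG]].
  by rewrite poly_unitE; case: eqP sP => // ->.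
have dFG : P %| F * G.
  by apply/Pdiv.WeakIdomain.dvdpP; exists (1, H); rewrite ?oner_eq0 //= scale1r FG mulrC.
have [cop|ncop] := boolP (coprimep P F).
  by right; apply: back; rewrite -(Gauss_dvdpr _ cop).
left; apply: back.
have dP := dvdp_gcdl P F; have dF := dvdp_gcdr P F.
set D := gcdp P F in dP dF.
have sD : size D != 1 by rewrite -coprimep_def.
case/Pdiv.WeakIdomain.dvdpP: (dP) => -[c Q] /= c0; rewrite -mul_polyC => e.
have [Q' [D' [PE sD']]] := gauss_split HA c0 e.
have : size P = size D.
  rewrite -sD'; have [|] := irr _ _ PE; rewrite poly_unitE => /andP[/eqP s1 _].
    rewrite PE size_mul ?s1 //; first by rewrite -size_poly_gt0 s1.
    by apply: contraNneq P0 => D'0; rewrite PE D'0 mulr0.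
  by case/eqP: sD; rewrite -sD'.
move/eqP; rewrite eq_sym (dvdp_size_eqp dP) => /eqp_dvdl <-.
exact: dF.
Qed.

(** Induction on the degree and, for a given degree, on the number of prime
    factors of the leading coefficient: the first drops when [P] is a product of
    two nonconstant polynomials, the second when a prime of [A] is extracted. *)
Lemma ufd_poly (A : idomainType) : ufd A -> ufd {poly A}.
Proof.
move=> HA P P0; have l0 : lead_coef P != 0 by rewrite lead_coef_eq0.
have [n] := ubnP (size P); have [u [s [Uu sP]]] := HA _ l0; have [k] := ubnP (size s).
elim: n k P P0 u s Uu sP {l0} => // n IHn; elim=> // k IHk P P0 u s Uu sP sk lE Pn.
have [[p [pP [Q PE]]]|PP] := pselect (exists p : A, prime_elt p /\ divides p%:P P).
  have p0 : p != 0 by case: pP.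
  rewrite PE; apply: factoredM; first exact/factored_prime/prime_polyC.
  have Q0 : Q != 0 by apply: contraNneq P0 => Q0; rewrite PE Q0 mulr0.
  have : p * lead_coef Q = u * \prod_(q <- s) q.
    by rewrite -lE PE mul_polyC lead_coefZ.
  case/(prime_cofactor pP Uu sP) => u' [s' [Uu' sP' lt lE']].
  apply: (IHk Q Q0 u' s') => //; first exact: leq_trans lt sk.
  by move: Pn; rewrite PE mul_polyC size_scale.
have {}PP : primitive_poly P by move=> p pP dp; apply: PP; exists p.
have constU F G : P = F * G -> (size F <= 1)%N -> F \is a GRing.unit.
  move=> PE sF; have := size1_polyC sF; set c := F`_0 => FE.
  apply: contrapT => /negP NF.
  have c0 : c != 0 by apply: contraNneq P0 => c0; rewrite PE FE c0 mul0r.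
  have [|p pP [e cE]] := ufd_prime_divisor HA c0.
    by apply: contra NF => Uc; rewrite FE rmorph_unit.
  by apply: (PP p pP); exists (e%:P * G); rewrite PE FE cE polyCM mulrA.
have [P1|P1] := leqP (size P) 1.
  by apply/factored_unit/(constU P 1); rewrite ?mulr1.
have [[F [G [PE NF NG]]]|irr] := pselect (exists F G, [/\ P = F * G,
    F \isn't a GRing.unit & G \isn't a GRing.unit]); last first.
  apply/factored_prime/gauss_prime => // F G PE; apply: contrapT => /not_orP[/negP NF /negP NG].
  by apply: irr; exists F, G.
have sF : (1 < size F)%N by rewrite ltnNge; apply: contra NF => /(constU F G PE).
have sG : (1 < size G)%N.
  by rewrite ltnNge; apply: contra NG => /(constU G F (etrans PE (mulrC _ _))).
have F0 : F != 0 by rewrite -size_poly_gt0 ltnW.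
have G0 : G != 0 by rewrite -size_poly_gt0 ltnW.
have sE : size P = (size F + size G).-1 by rewrite PE size_mul.
have rec (H : {poly A}) : H != 0 -> (size H < n)%N -> factored H.
  move=> H0 Hn; have l0 : lead_coef H != 0 by rewrite lead_coef_eq0.
  have [v [t [Uv tP lH]]] := HA _ l0.
  exact: (IHn (size t).+1 H H0 v t).
rewrite PE; apply: factoredM; apply: rec => //.
- move: Pn; rewrite sE; case: (size G) sG => [|[|b]] // _.
  by rewrite !addnS /= ltnS; apply: leq_trans; rewrite ltnS leq_addr.
- move: Pn; rewrite sE; case: (size F) sF => [|[|a]] // _.
  by rewrite !addSn /= ltnS; apply: leq_trans; rewrite ltnS leq_addl.
Qed.

Lemma ufd_iso (A B : idomainType) (phi : {rmorphism A -> B}) (psi : B -> A) :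
  cancel phi psi -> cancel psi phi -> ufd B -> ufd A.
Proof.
move=> phiK psiK HB x x0.
have inj := can_inj phiK.
have divE a b : divides (phi a) (phi b) <-> divides a b.
  split=> [[c cE]|[c ->]]; last by exists (phi c); rewrite rmorphM.
  by exists (psi c); apply: inj; rewrite rmorphM psiK.
have unitE a : (phi a \is a GRing.unit) = (a \is a GRing.unit).
  apply/idP/idP => [/unitrP[b [ba ab]]|]; last exact: rmorph_unit.
  by apply/unitrP; exists (psi b); split; apply: inj; rewrite rmorphM psiK rmorph1.
have primeE p : prime_elt p -> prime_elt (psi p).
  move=> [p0 Np Hp]; split.
  - by apply: contraNneq p0 => p0; rewrite -[p]psiK p0 rmorph0.
  - by rewrite -unitE psiK.
  by move=> a b /divE; rewrite psiK rmorphM => /Hp; rewrite -{1 2}[p]psiK !divE.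
have [|u [s [Uu sP xE]]] := HB (phi x).
  by apply: contraNneq x0 => x0; apply/eqP/inj; rewrite x0 rmorph0.
exists (psi u), (map psi s); split.
- by rewrite -unitE psiK.
- by move=> _ /mapP[p /sP pP ->]; apply: primeE.
apply: inj; rewrite xE rmorphM rmorph_prod psiK big_map; congr (_ * _).
by apply: eq_bigr => p _; rewrite psiK.
Qed.

Lemma muni_mwiden (n : nat) (A : comNzRingType) (q : {mpoly A[n]}) :
  muni (mwiden q) = q%:P.
Proof.
rewrite [q in LHS]mpolyE [q in RHS]mpolyE (raddf_sum (@mwiden n A)).
rewrite (raddf_sum (@muni n A)) (raddf_sum (@polyC _)) /=.
apply: eq_bigr => m _.
rewrite mwidenZ mwidenX muniZ muniE msuppX big_seq1 mcoeffX eqxx scale1r.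
rewrite mnmwiden_ordmax expr0 -mul_mpolyC polyCM -!mul_polyC mulr1.
by congr (_ * 'X_[_]%:P); apply/mnmP => i; rewrite mnmE mnmwiden_widen.
Qed.

Lemma muni_Xmax (n : nat) (A : comNzRingType) :
  muni ('X_ord_max : {mpoly A[n.+1]}) = 'X.
Proof.
rewrite muniE msuppX big_seq1 mcoeffX eqxx scale1r mnm1E eqxx expr1.
rewrite (_ : [multinom _ | _ < n] = 0%MM) ?mpolyX0 ?scale1r //.
apply/mnmP=> i; rewrite mnmE mnm1E mnm0E.
by case: eqP => // /(congr1 val) /= e; have := ltn_ord i; rewrite -e ltnn.
Qed.

Lemma mmultiK (n : nat) (A : comNzRingType) : cancel (@mmulti n A) (@muni n A).
Proof.
move=> P; rewrite /mmulti rmorph_sum -[RHS]coefK poly_def; apply: eq_bigr => i _.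
by rewrite /= rmorphM rmorphXn /= muni_mwiden muni_Xmax mul_polyC.
Qed.

Lemma muniK (n : nat) (A : comNzRingType) : cancel (@muni n A) (@mmulti n A).
Proof.
have mmultiE (P : {poly {mpoly A[n]}}) :
    mmulti P = (map_poly (@mwiden n A) P).['X_ord_max].
  rewrite horner_coef size_map_inj_poly ?mwiden0 //; last exact: inj_mwiden.
  by apply: eq_bigr => i _; rewrite coef_map.
move=> p; rewrite mmultiE muniE [RHS]mpolyE.
rewrite rmorph_sum horner_sum; apply: eq_bigr => m _.
rewrite -mul_polyC rmorphM /= map_polyC map_polyXn hornerM hornerC hornerXn /=.
rewrite mwidenZ mwidenX mpolyXn -scalerAl -mpolyXD; congr (_ *: 'X_[_]).
apply/mnmP => i; rewrite mnmDE mulmnE mnm1E.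
have [j ->|->] := unliftP ord_max i.
  rewrite (_ : lift ord_max j = widen_ord (leqnSn n) j); last first.
    by apply/val_inj; rewrite /= /bump leqNgt ltn_ord.
  rewrite mnmwiden_widen mnmE; case: eqP => [/(congr1 val) /= e|_]; last by rewrite addn0.
  by have := ltn_ord j; rewrite -e ltnn.
by rewrite mnmwiden_ordmax eqxx mul1n.
Qed.

Lemma ufd_mpoly (F : fieldType) (n : nat) : ufd {mpoly F[n]}.
Proof.
elim: n => [|n IH]; last first.
  apply: (ufd_iso (@muniK n F) (@mmultiK n F)).
  exact: ufd_poly.
move=> x x0; apply/factored_unit.
rewrite -[x]mpolyKC rmorph_unit // unitfE.
by apply: contraNneq x0 => e; rewrite -[x]mpolyKC e rmorph0.
Qed.

(** * Homogeneous polynomials and derivatives *)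

Lemma dhomog_mderiv (n : nat) (A : nzRingType) (d : nat) (p : {mpoly A[n]}) (i : 'I_n) :
  p \is d.-homog -> p^`M(i) \is d.-1.-homog.
Proof.
move=> /dhomogP hp; apply/dhomogP=> m; rewrite mcoeff_msupp mcoeff_deriv => nz.
have /hp : (m + U_(i))%MM \in msupp p.
  by rewrite mcoeff_msupp; apply: contraNneq nz => ->; rewrite mul0rn.
by move=> /=; rewrite mdegD mdeg1 addn1 => <-.
Qed.

Lemma euler_formula (n : nat) (A : comNzRingType) (d : nat) (p : {mpoly A[n]}) :
  p \is d.-homog -> \sum_(i < n) 'X_i * p^`M(i) = p *+ d.
Proof.
move=> /dhomogP hp; rewrite {2}[p]mpolyE -sumrMnl.
transitivity (\sum_(i < n) \sum_(m <- msupp p) (p@_m *: 'X_[m]) *+ m i).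
  apply: eq_bigr => i _; rewrite {1}[p]mpolyE raddf_sum mulr_sumr /=.
  apply: eq_bigr => m _; rewrite mderivZ mderivX -!scalerAr scaler_nat -scalerMnr -mpolyXD.
  case: (posnP (m i)) => [->|mi]; first by rewrite !mulr0n.
  by rewrite addmC submK //; apply/mnm_lepP => j; rewrite mnm1E; case: eqP => // <-.
rewrite exchange_big /=; apply: eq_big_seq => m mp.
by rewrite -(hp m mp) /= mdegE sumrMnr.
Qed.

Lemma mcoeff_pihomog (n : nat) (A : nzRingType) (k : nat) (p : {mpoly A[n]}) m :
  (pihomog mdeg k p)@_m = p@_m *+ (mdeg m == k).
Proof.
rewrite /pihomog raddf_sum /=.
under eq_bigr => m' _ do rewrite mcoeffZ mcoeffX.
rewrite big_mkcond /=; have [mp|mp] := boolP (m \in msupp p).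
  rewrite (bigD1_seq m) //= eqxx mulr1 big1 ?addr0 => [|m' /negbTE->].
    by case: eqP.
  by rewrite mulr0 if_same.
rewrite (memN_msupp_eq0 mp) mul0rn big1_seq // => m' /andP[_ m'p].
case: eqP => // _; case: eqP => [mE|]; last by rewrite mulr0.
by rewrite -mE m'p in mp.
Qed.

Lemma pihomogM (n : nat) (A : comNzRingType) (k : nat) (p q : {mpoly A[n]}) :
  pihomog mdeg k (p * q) =
  \sum_(i < k.+1) pihomog mdeg i p * pihomog mdeg (k - i) q.
Proof.
elim/mpolyind: p => [|c m p _ _ IH].
  by rewrite mul0r raddf0 big1 // => i _; rewrite raddf0 mul0r.
rewrite mulrDl raddfD /= {}IH.
under [RHS]eq_bigr => i _ do rewrite raddfD /= mulrDl.
rewrite [RHS]big_split /=; congr (_ + _).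
elim/mpolyind: q => [|c' m' q _ _ IH].
  by rewrite mulr0 raddf0 big1 // => i _; rewrite raddf0 mulr0.
rewrite mulrDr raddfD /= {}IH.
under [RHS]eq_bigr => i _ do rewrite raddfD /= mulrDr.
rewrite [RHS]big_split /=; congr (_ + _).
rewrite -scalerAl -scalerAr -mpolyXD !linearZ /= pihomogX /= mdegD.
under [RHS]eq_bigr => i _ do rewrite !linearZ /= !pihomogX.
have [lt|ge] := ltnP (mdeg m) k.+1.
  rewrite (bigD1 (Ordinal lt)) //= eqxx big1 ?addr0 => [|i ni].
    rewrite -[mdeg m' == _](eqn_add2l (mdeg m)) subnKC -1?ltnS // -scalerAl.
    by case: eqP => _; rewrite -?scalerAr ?mulr0 ?scaler0 ?mpolyXD.
  case: eqP => [mi|]; last by rewrite scaler0 mul0r.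
  by case/eqP: ni; apply: val_inj.
rewrite gtn_eqF ?(leq_trans ge) ?leq_addr // !scaler0 big1 // => i _.
by rewrite gtn_eqF ?scaler0 ?mul0r // (leq_trans (ltn_ord i)).
Qed.

Lemma pihomogM_homog (n : nat) (A : comNzRingType) (k e : nat) (p q : {mpoly A[n]}) :
  q \is e.-homog ->
  pihomog mdeg k (p * q) = if (e <= k)%N then pihomog mdeg (k - e) p * q else 0.
Proof.
move=> hq; rewrite pihomogM; case: leqP => [le|lt].
  have lt : (k - e < k.+1)%N by rewrite ltnS leq_subr.
  rewrite (bigD1 (Ordinal lt)) //= subKn // (pihomog_dE hq) big1 ?addr0 // => i ni.
  rewrite (pihomog_ne0 _ hq) ?mulr0 //; apply: contra ni => /eqP ee.
  by apply/eqP/val_inj; rewrite /= ee subKn // -ltnS.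
rewrite big1 // => i _; rewrite (pihomog_ne0 _ hq) ?mulr0 //.
by rewrite gtn_eqF // (leq_ltn_trans (leq_subr _ _)).
Qed.

Lemma pihomog_eq0P (n : nat) (A : nzRingType) (p : {mpoly A[n]}) :
  p != 0 -> exists k, pihomog mdeg k p != 0.
Proof.
move=> p0; exists (mdeg (mlead p)); apply: contraNneq p0.
by move/(congr1 (mcoeff (mlead p)))/eqP; rewrite mcoeff_pihomog eqxx mcoeff0 mulr1n mleadc_eq0.
Qed.

(** Compare the lowest and the highest degrees of the factors with those of the
    product. *)
Lemma dhomog_factor (n : nat) (A : idomainType) (d : nat) (p q : {mpoly A[n]}) :
    p != 0 -> q != 0 -> p * q \is d.-homog ->
  [/\ p \is (msize p).-1.-homog, q \is (msize q).-1.-homog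
    & ((msize p).-1 + (msize q).-1)%N = d].
Proof.
move=> p0 q0 hpq.
have low (r : {mpoly A[n]}) : r != 0 -> exists a, [/\ pihomog mdeg a r != 0,
    forall b, (b < a)%N -> pihomog mdeg b r = 0, (a <= (msize r).-1)%N
    & (a = (msize r).-1 -> r \is (msize r).-1.-homog)].
  move=> r0; case: (ex_minnP (pihomog_eq0P r0)) => a ra min.
  have zero b : (b < a)%N -> pihomog mdeg b r = 0.
    by move=> ba; apply/eqP; apply: contraTT ba => /min; rewrite -leqNgt.
  have supp m : m \in msupp r -> (a <= mdeg m < msize r)%N.
    move=> mr; rewrite msize_mdeg_lt // andbT leqNgt; apply/negP => /zero.
    move/(congr1 (mcoeff m))/eqP; rewrite mcoeff_pihomog eqxx mcoeff0 mulr1n.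
    by apply/negP; rewrite -mcoeff_msupp.
  have sr : (0 < msize r)%N by rewrite lt0n msize_poly_eq0.
  exists a; split=> // [|aE].
    by have /andP[le lt] := supp _ (mlead_supp r0); rewrite -ltnS prednK // (leq_ltn_trans le lt).
  apply/dhomogP => m /supp /andP[le lt]; apply/eqP; rewrite eqn_leq -{1}ltnS prednK // lt /=.
  by rewrite -aE.
have [a [pa pz la Ha]] := low p p0; have [b [qb qz lb Hb]] := low q q0.
have dE : ((msize p).-1 + (msize q).-1)%N = d.
  have pq0 : p * q != 0 by rewrite mulf_neq0.
  have /= := dhomog_mf hpq (mlead_supp pq0); rewrite mleadM // mdegD => <-.
  by rewrite -!mlead_deg.
have abd : (a + b)%N = d.
  apply/eqP; apply: contraT => ne; have := pihomog_ne0 _ hpq.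
  move/(_ (a + b)%N); rewrite eq_sym => /(_ ne) /eqP; rewrite pihomogM.
  have lt : (a < (a + b).+1)%N by rewrite ltnS leq_addr.
  rewrite (bigD1 (Ordinal lt)) //= addKn big1 ?addr0 ?mulf_eq0 ?(negPf pa) ?(negPf qb) // => i ni.
  have [ia|ai] := ltnP i a; first by rewrite pz ?mul0r.
  rewrite qz ?mulr0 // ltn_subLR; last by rewrite -ltnS.
  rewrite ltn_add2r ltn_neqAle ai andbT; apply: contra ni => /eqP ai'.
  by apply/eqP/val_inj.
have [aE bE] : a = (msize p).-1 /\ b = (msize q).-1.
  suff aE : a = (msize p).-1.
    by split=> //; apply/eqP; rewrite -(eqn_add2l a) abd aE dE.
  apply/eqP; rewrite eqn_leq la /= -(leq_add2r b) abd -dE leq_add2l.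
  exact: lb.
by split=> //; [apply: Ha | apply: Hb].
Qed.

Lemma mpoly_unitE (F : fieldType) (n : nat) (p : {mpoly F[n]}) :
  (p \is a GRing.unit) = (msize p == 1).
Proof.
apply/idP/idP => [/unitrP[q [qp _]]|/msize_poly1P[c c0 ->]].
  have p0 : p != 0 by apply: contra_eqN qp => /eqP->; rewrite mulr0 eq_sym oner_eq0.
  have q0 : q != 0 by apply: contra_eqN qp => /eqP->; rewrite mul0r eq_sym oner_eq0.
  have := msizeM q0 p0; rewrite qp msize1.
  move: p0 q0; rewrite -!msize_poly_eq0.
  by case: (msize p) (msize q) => [|[|a]] [|b] //; rewrite !addnS.
by rewrite rmorph_unit // unitfE.
Qed.

Lemma msize_prime (F : fieldType) (n : nat) (p : {mpoly F[n]}) :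
  prime_elt p -> (1 < msize p)%N.
Proof.
case=> p0 Np _; rewrite ltn_neqAle eq_sym -mpoly_unitE Np /=.
by rewrite lt0n msize_poly_eq0.
Qed.

Lemma msize_divides (A : idomainType) (n : nat) (p q : {mpoly A[n]}) :
  q != 0 -> divides p q -> (msize p <= msize q)%N.
Proof.
move=> q0 [r qE]; have p0 : p != 0 by apply: contraNneq q0 => e; rewrite qE e mul0r.
have r0 : r != 0 by apply: contraNneq q0 => e; rewrite qE e mulr0.
rewrite qE msizeM //; move: r0; rewrite -msize_poly_eq0.
by case: (msize r) => // k _; rewrite addnS leq_addr.
Qed.

Lemma msize_mderiv (A : nzRingType) (n : nat) (p : {mpoly A[n]}) (i : 'I_n) :
  p^`M(i) != 0 -> (msize p^`M(i) < msize p)%N.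
Proof.
move=> /[dup] d0 /mlead_supp; rewrite -mlead_deg // mcoeff_msupp mcoeff_deriv => nz.
have /msize_mdeg_lt : (mlead p^`M(i) + U_(i))%MM \in msupp p.
  by rewrite mcoeff_msupp; apply: contraNneq nz => ->; rewrite mul0rn.
by rewrite mdegD mdeg1 addn1.
Qed.

Lemma mderiv_eq0 (K : numFieldType) (n : nat) (p : {mpoly K[n]}) :
  (forall i, p^`M(i) = 0) -> (msize p <= 1)%N.
Proof.
move=> dp; have [->|p0] := eqVneq p 0; first by rewrite msize0.
rewrite -mlead_deg // ltnS leqn0 mdeg_eq0; apply/eqP/mnmP => i; rewrite mnm0E.
apply/eqP; apply: contraT; rewrite -lt0n => mi.
have := congr1 (mcoeff (mlead p - U_(i))%MM) (dp i).
rewrite mcoeff_deriv mcoeff0 submK; last first.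
  by apply/mnm_lepP => j; rewrite mnm1E; case: eqP => // <-.
by move/eqP; rewrite mulrn_eq0 /= mleadc_eq0 (negPf p0).
Qed.

Lemma meval_homog (A : comNzRingType) (n d : nat) (p : {mpoly A[n]}) (v : 'I_n -> A) (c : A) :
  p \is d.-homog -> p.@[fun i => c * v i] = c ^+ d * p.@[v].
Proof.
move=> /dhomogP hp; rewrite !mevalE mulr_sumr; apply: eq_big_seq => m mp.
rewrite mulrCA -(hp m mp) /= mdegE -prodrXr -big_split /=; congr (_ * _).
by apply: eq_bigr => i _; rewrite exprMn.
Qed.

(** * Finite generation of graded submodules *)

Definition submodule (A : comNzRingType) (N : nat) (M : 'rV[A]_N -> Prop) : Prop :=
  M 0 /\ forall c u v, M u -> M v -> M (c *: u + v).

(** Being in every submodule that contains the generators, rather than being a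
    linear combination of them: membership then depends only on the
    set of generators, and no coefficients have to be renumbered when a list is
    reordered or extended. *)
Definition spanned (A : comNzRingType) (N : nat) (s : seq 'rV[A]_N) (u : 'rV[A]_N) : Prop :=
  forall M, submodule M -> {in s, forall v, M v} -> M u.

Lemma submoduleZ (A : comNzRingType) (N : nat) (M : 'rV[A]_N -> Prop) c u :
  submodule M -> M u -> M (c *: u).
Proof. by move=> [M0 HM] Mu; rewrite -[_ *: _]addr0; apply: HM. Qed.

Lemma submoduleD (A : comNzRingType) (N : nat) (M : 'rV[A]_N -> Prop) u v :
  submodule M -> M u -> M v -> M (u + v).
Proof. by move=> [M0 HM] Mu Mv; rewrite -[u]scale1r; apply: HM. Qed.

Lemma submodule_sum (A : comNzRingType) (N : nat) (M : 'rV[A]_N -> Prop)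
    (I : Type) (r : seq I) (P : pred I) (E : I -> 'rV[A]_N) :
  submodule M -> (forall i, P i -> M (E i)) -> M (\sum_(i <- r | P i) E i).
Proof.
move=> HM ME; apply: big_ind => //; first by case: HM.
by move=> u v; apply: submoduleD.
Qed.

Lemma spanned_submodule (A : comNzRingType) (N : nat) (s : seq 'rV[A]_N) :
  submodule (spanned s).
Proof.
split=> [M [] //|c u v su sv M HM Ms].
by case: (HM) => _; apply; [apply: su | apply: sv].
Qed.

Lemma spanned_mem (A : comNzRingType) (N : nat) (s : seq 'rV[A]_N) u :
  u \in s -> spanned s u.
Proof. by move=> us M _; apply. Qed.

Lemma spanned_sub (A : comNzRingType) (N : nat) (s t : seq 'rV[A]_N) u :
  {subset s <= t} -> spanned s u -> spanned t u.
Proof. by move=> st su M HM Mt; apply: su => // v /st /Mt. Qed.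

(** Dickson's lemma, for the first [n] of a sequence of measures [mu]. In the
    induction step, the finitely many witnesses for [n] measures bound the next
    measure by some [b]; elements below [b] fall into [b] slices, each with
    witnesses of its own. *)
Lemma dickson (T : eqType) (mu : nat -> T -> nat) (n : nat) (P : T -> Prop) :
  exists s : seq T, {in s, forall x, P x} /\
    forall x, P x -> exists2 y, y \in s & forall i, (i < n)%N -> (mu i y <= mu i x)%N.
Proof.
elim: n P => [|n IH] P.
  have [[x Px]|NP] := pselect (exists x, P x); last first.
    by exists [::]; split=> // x Px; case: NP; exists x.
  exists [:: x]; split=> [y|y _]; first by rewrite inE => /eqP->.
  by exists x; rewrite ?mem_head.
have [s [sP sdom]] := IH P.
pose b := (\max_(y <- s) mu n y).+1.
have [t [tP tdom]] : exists t : seq T, {in t, forall x, P x} /\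
    forall x, P x -> (mu n x < b)%N ->
      exists2 y, y \in t & forall i, (i < n.+1)%N -> (mu i y <= mu i x)%N.
  elim: b => [|b [t [tP tdom]]]; first by exists [::].
  have [r [rP rdom]] := IH (fun x => P x /\ mu n x = b).
  exists (r ++ t); split=> [x|x Px].
    by rewrite mem_cat => /orP[/rP[]|/tP].
  rewrite ltnS leq_eqVlt => /predU1P[xb|/(tdom x Px)[y yt yx]]; last first.
    by exists y; rewrite // mem_cat yt orbT.
  have [y yr yx] := rdom x (conj Px xb); exists y; rewrite ?mem_cat ?yr // => i.
  rewrite ltnS leq_eqVlt => /predU1P[->|/yx //].
  by have [_ ->] := rP y yr; rewrite xb.
exists (s ++ t); split=> [x|x Px].
  by rewrite mem_cat => /orP[/sP|/tP].
have [/(tdom x Px)[y yt yx]|bx] := ltnP (mu n x) b.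
  by exists y; rewrite // mem_cat yt orbT.
have [y ys yx] := sdom x Px; exists y; rewrite ?mem_cat ?ys // => i.
rewrite ltnS leq_eqVlt => /predU1P[->|/yx //].
by apply: leq_trans (ltnW bx); rewrite -/(leq _ _); apply: leq_bigmax_seq.
Qed.

Lemma mlead_sub_lt (A : nzRingType) (n : nat) (p q : {mpoly A[n]}) :
    mlead p = mlead q -> mleadc p = mleadc q -> p - q != 0 ->
  (mlead (p - q) < mlead p)%O.
Proof.
move=> lE cE pq0; rewrite lt_neqAle; apply/andP; split.
  apply: contra pq0 => /eqP e; rewrite -mleadc_eq0 e mcoeffB.
  by rewrite cE lE subrr.
by apply: le_trans (mleadB_le p q) _; rewrite -lE joinxx.
Qed.

Definition graded_vec (A : comNzRingType) (n N : nat) (k : nat) (u : 'rV[{mpoly A[n]}]_N) : Prop :=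
  forall i, u 0 i \is k.-homog.

(** Hilbert's basis theorem for the homogeneous elements, by descending
    induction on the number [k] of leading zero entries: the [k]-th entries have
    finitely many minimal leading monomials, and subtracting a multiple of the
    corresponding element lowers the leading monomial. *)
Lemma graded_hilbert_basis (F : fieldType) (n N : nat) (M : 'rV[{mpoly F[n]}]_N -> Prop) :
    submodule M ->
  exists s : seq 'rV[{mpoly F[n]}]_N,
    {in s, forall u, M u /\ exists k, graded_vec k u} /\
    forall k u, M u -> graded_vec k u -> spanned s u.
Proof.
move=> HM.
suff /(_ 0%N (leq0n _)) [s [sM sgen]] : forall k, (k <= N)%N -> exists s : seq 'rV[{mpoly F[n]}]_N,
    {in s, forall u, M u /\ exists e, graded_vec e u} /\
    forall e u, M u -> graded_vec e u -> (forall j : 'I_N, (j < k)%N -> u 0 j = 0) -> spanned s u.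
  by exists s; split=> // k u Mu hu; apply: (sgen k).
move=> k kN; rewrite -(subKn kN); elim: (N - k)%N (leq_subr k N) => {k kN} [|k IH] kN.
  exists [::]; split=> // e u _ _ u0; suff -> : u = 0 by apply: (proj1 (spanned_submodule _)).
  by apply/rowP => j; rewrite mxE u0 // subn0.
have [s [sM sgen]] := IH (ltnW kN).
have ltN : (N - k.+1 < N)%N by rewrite ltn_subrL /= (leq_ltn_trans _ kN).
pose i := Ordinal ltN.
pose P (u : 'rV[{mpoly F[n]}]_N) := [/\ M u, exists e, graded_vec e u,
  forall j : 'I_N, (j < i)%N -> u 0 j = 0 & u 0 i != 0].
pose mu l (u : 'rV[{mpoly F[n]}]_N) := nth 0%N (mlead (u 0 i)) l.
have [t [tP tdom]] := dickson mu n P.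
have leS j : (j < N - k)%N -> j = i \/ (j < i)%N.
  by rewrite -(subnSK kN) ltnS leq_eqVlt => /predU1P[->|]; [left|right].
exists (t ++ s); split=> [u|e u].
  by rewrite mem_cat => /orP[/tP[]|/sM].
have sub_s : {subset s <= t ++ s} by move=> v vs; rewrite mem_cat vs orbT.
have base v : M v -> graded_vec e v -> (forall j : 'I_N, (j < i)%N -> v 0 j = 0) ->
    v 0 i = 0 -> spanned (t ++ s) v.
  move=> Mv hv v0 vi; apply: (spanned_sub sub_s); apply: (sgen e) => // j /leS[ji|/v0 //].
  by rewrite (val_inj ji : j = i).
move eqm: (mlead (u 0 i)) => m; elim/(@ltmwf n): m u eqm => m IHm u um Mu hu u0.
have [ui|ui] := eqVneq (u 0 i) 0; first exact: base.
have [v [vt vu]] : exists v : 'rV[{mpoly F[n]}]_N,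
    v \in t /\ forall l, (l < n)%N -> (mu l v <= mu l u)%N.
  by have [|v vt vu] := tdom u; [split=> //; exists e | exists v].
have [Mv [d hv] v0 vi] := tP v vt.
have lev : (mlead (v 0%R i) <= m)%MM.
  by apply/mnm_lepP => j; have := vu j (ltn_ord j); rewrite /mu -!mnm_nth um.
pose c := mleadc (u 0 i) / mleadc (v 0 i).
pose x : {mpoly F[n]} := c *: 'X_[m - mlead (v 0%R i)].
have lv0 : mleadc (v 0 i) != 0 by rewrite mleadc_eq0.
have lu0 : mleadc (u 0 i) != 0 by rewrite mleadc_eq0.
have c0 : c != 0 by rewrite mulf_neq0 ?invr_eq0.
have lE : mlead (x * v 0 i) = m.
  have X0 : 'X_[m - mlead (v 0%R i)] != 0 :> {mpoly F[n]}.
    by rewrite -mleadc_eq0 mleadXm mcoeffX eqxx oner_eq0.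
  by rewrite /x -scalerAl mleadZ // mleadM // (@mleadXm n F) submK.
have cE : mleadc (x * v 0 i) = mleadc (u 0 i).
  have := mcoeffMX (v 0 i) (m - mlead (v 0%R i)) (mlead (v 0 i)).
  by rewrite submK // mulrC lE /x -scalerAl mcoeffZ => ->; rewrite divfK.
pose w := u - x *: v.
have wE j : w 0 j = u 0 j - x * v 0 j by rewrite !mxE.
have uE : u = x *: v + w by rewrite addrC subrK.
have Mw : M w.
  by rewrite /w -scaleNr addrC; case: HM => _; apply.
have de : (mdeg (m - mlead (v 0%R i)) + d)%N = e.
  have /= <- := dhomog_mf (hu i) (mlead_supp ui).
  have /= <- := dhomog_mf (hv i) (mlead_supp vi).
  by rewrite -mdegD submK // um.
have hw : graded_vec e w.
  move=> j; rewrite wE rpredB // -de; apply: dhomogM => //.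
  by rewrite rpredZ // dhomogX.
have w0 (j : 'I_N) : (j < i)%N -> w 0 j = 0.
  by move=> ji; rewrite wE u0 // v0 // mulr0 subrr.
rewrite uE; apply: (submoduleD (spanned_submodule _)).
  apply: (submoduleZ _ (spanned_submodule _)); apply: spanned_mem.
  by rewrite mem_cat vt.
have [wi|wi] := eqVneq (w 0 i) 0; first exact: base.
apply: (IHm (mlead (w 0 i))) => //; rewrite wE -um mlead_sub_lt ?lE -?wE //.
by rewrite -cE lE -um.
Qed.

(** * Cross products in rank three *)

Lemma forall_ord3 (P : 'I_3 -> Prop) : P 0 -> P 1 -> P 2 -> forall i, P i.
Proof.
by move=> P0 P1 P2 [[|[|[|i]]] //= lt]; [move: P0|move: P1|move: P2];
  congr P; apply: val_inj.
Qed.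

Lemma sum_ord3 (V : nmodType) (F : 'I_3 -> V) : \sum_i F i = F 0 + F 1 + F 2.
Proof.
rewrite !big_ord_recl big_ord0 addr0 addrA.
by congr (F _ + F _ + F _); apply: val_inj.
Qed.

Definition dot (A : comNzRingType) (u v : 'rV[A]_3) : A := \sum_i u 0 i * v 0 i.

Definition cross (A : comNzRingType) (u v : 'rV[A]_3) : 'rV[A]_3 :=
  \row_(i < 3) [:: u 0 1 * v 0 2 - u 0 2 * v 0 1;
                   u 0 2 * v 0 0 - u 0 0 * v 0 2;
                   u 0 0 * v 0 1 - u 0 1 * v 0 0]`_i.

Lemma dotE (A : comNzRingType) (u v : 'rV[A]_3) :
  dot u v = u 0 0 * v 0 0 + u 0 1 * v 0 1 + u 0 2 * v 0 2.
Proof. exact: sum_ord3. Qed.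

Lemma crossE (A : comNzRingType) (u v : 'rV[A]_3) :
  (cross u v 0 0 = u 0 1 * v 0 2 - u 0 2 * v 0 1) *
  (cross u v 0 1 = u 0 2 * v 0 0 - u 0 0 * v 0 2) *
  (cross u v 0 2 = u 0 0 * v 0 1 - u 0 1 * v 0 0).
Proof. by rewrite !mxE. Qed.

Lemma row3P (A : comNzRingType) (u v : 'rV[A]_3) :
  u 0 0 = v 0 0 -> u 0 1 = v 0 1 -> u 0 2 = v 0 2 -> u = v.
Proof. by move=> e0 e1 e2; apply/rowP; apply: forall_ord3. Qed.

Lemma crossC (A : comNzRingType) (u v : 'rV[A]_3) : cross v u = - cross u v.
Proof. by apply: row3P; rewrite !crossE mxE crossE; ring. Qed.

Lemma crossC_eq0 (A : comNzRingType) (u v : 'rV[A]_3) :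
  (cross v u == 0) = (cross u v == 0).
Proof. by rewrite crossC oppr_eq0. Qed.

Lemma crossDl (A : comNzRingType) (u v w : 'rV[A]_3) :
  cross (u + v) w = cross u w + cross v w.
Proof. by apply: row3P; rewrite [RHS]mxE !crossE !mxE; ring. Qed.

Lemma crossZl (A : comNzRingType) (a : A) (u w : 'rV[A]_3) :
  cross (a *: u) w = a *: cross u w.
Proof. by apply: row3P; rewrite [RHS]mxE !crossE !mxE; ring. Qed.

Lemma crossDr (A : comNzRingType) (u v w : 'rV[A]_3) :
  cross w (u + v) = cross w u + cross w v.
Proof. by rewrite crossC crossDl opprD -!(crossC _ w). Qed.

Lemma crossZr (A : comNzRingType) (a : A) (u w : 'rV[A]_3) :
  cross w (a *: u) = a *: cross w u.
Proof. by rewrite crossC crossZl -scalerN -crossC. Qed.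

Lemma crossvv (A : comNzRingType) (u : 'rV[A]_3) : cross u u = 0.
Proof. by apply: row3P; rewrite !crossE mxE; ring. Qed.

Lemma cross0l (A : comNzRingType) (u : 'rV[A]_3) : cross 0 u = 0.
Proof. by apply: row3P; rewrite !crossE !mxE; ring. Qed.

Lemma cross0r (A : comNzRingType) (u : 'rV[A]_3) : cross u 0 = 0.
Proof. by rewrite crossC cross0l oppr0. Qed.

Lemma cross_suml (A : comNzRingType) (I : Type) (r : seq I) (P : pred I)
    (E : I -> 'rV[A]_3) w :
  cross (\sum_(i <- r | P i) E i) w = \sum_(i <- r | P i) cross (E i) w.
Proof.
by apply: (big_morph (fun u => cross u w)) => [u v|]; rewrite ?crossDl ?cross0l.
Qed.

Lemma cross_sumr (A : comNzRingType) (I : Type) (r : seq I) (P : pred I)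
    (E : I -> 'rV[A]_3) w :
  cross w (\sum_(i <- r | P i) E i) = \sum_(i <- r | P i) cross w (E i).
Proof. by apply: (big_morph (cross w)) => [u v|]; rewrite ?crossDr ?cross0r. Qed.

Lemma dotDl (A : comNzRingType) (u v w : 'rV[A]_3) : dot (u + v) w = dot u w + dot v w.
Proof. by rewrite !dotE !mxE; ring. Qed.

Lemma dotZl (A : comNzRingType) (a : A) (u w : 'rV[A]_3) : dot (a *: u) w = a * dot u w.
Proof. by rewrite !dotE !mxE; ring. Qed.

Lemma dot_cross_self (A : comNzRingType) (u v : 'rV[A]_3) : dot (cross u v) v = 0.
Proof. by rewrite dotE !crossE; ring. Qed.

Lemma cross_cross (A : comNzRingType) (u v g : 'rV[A]_3) :
  cross (cross u v) g = dot u g *: v - dot v g *: u.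
Proof. by apply: row3P; rewrite !crossE !mxE !dotE; ring. Qed.

Lemma cross_eq0 (A : comNzRingType) (u v : 'rV[A]_3) :
  cross u v = 0 -> forall i j, u 0 i * v 0 j = u 0 j * v 0 i.
Proof.
move=> e; have e0 := congr1 (fun w : 'rV_3 => w 0 0) e.
have e1 := congr1 (fun w : 'rV_3 => w 0 1) e.
have e2 := congr1 (fun w : 'rV_3 => w 0 2) e.
move: e0 e1 e2; rewrite /= !crossE !mxE => /subr0_eq e0 /subr0_eq e1 /subr0_eq e2.
by apply: forall_ord3; apply: forall_ord3.
Qed.

(** Cramer's rule, in a form that exhibits a linear relation between three
    vectors whose determinant vanishes. *)
Lemma cramer3 (A : comNzRingType) (u v w : 'rV[A]_3) i :
  cross v w 0 i *: u + cross w u 0 i *: v + cross u v 0 i *: w =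
  dot (cross u v) w *: delta_mx 0 i.
Proof.
by move: i; apply: forall_ord3; apply: row3P; rewrite !(dotE, mxE) /=; ring.
Qed.

(** [cross a g] and [cross b g] are Koszul relations. As [dot (cross a b) g] can
    be made equal to any entry of [g], every multiple [g_i g] is the cross
    product of two vectors orthogonal to [g]. *)
Lemma cross_koszul (A : comNzRingType) (a b g : 'rV[A]_3) :
  cross (cross a g) (cross b g) = dot (cross a b) g *: g.
Proof. by apply: row3P; rewrite [RHS]mxE !(dotE, crossE); ring. Qed.

Lemma cross_delta (A : comNzRingType) (i : 'I_3) :
  exists a b : 'rV[A]_3, cross a b = delta_mx 0 i.
Proof.
move: i; apply: forall_ord3;
  [exists (delta_mx 0 1), (delta_mx 0 2)|exists (delta_mx 0 2), (delta_mx 0 0)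
  |exists (delta_mx 0 0), (delta_mx 0 1)];
  by apply: row3P; rewrite crossE !mxE /=; ring.
Qed.

Lemma dot_delta (A : comNzRingType) (g : 'rV[A]_3) i : dot (delta_mx 0 i) g = g 0 i.
Proof. by move: i; apply: forall_ord3; rewrite dotE !mxE /=; ring. Qed.

Lemma row_neq0 (A : comNzRingType) (N : nat) (u : 'rV[A]_N) :
  u != 0 -> exists i, u 0 i != 0.
Proof.
move=> u0; apply: contrapT => H; case/eqP: u0; apply/rowP => i; rewrite mxE.
by apply: contrapT => /eqP ui; apply: H; exists i.
Qed.

(** Adding multiples of [w] to [u] and [v] does not change the determinant of
    [u], [v] and [w]. *)
Lemma dot_cross_shift (A : comNzRingType) (g a b : A) (u v w : 'rV[A]_3) :
  dot (cross (g *: u + a *: w) (g *: v + b *: w)) w = g ^+ 2 * dot (cross u v) w.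
Proof. by rewrite !dotE !crossE !mxE; ring. Qed.

(** * Saito's criterion *)

(** The double product formula expands [cross (cross u v) g] in terms of the two
    products that vanish. *)
Lemma cross_parallel (A : comNzRingType) (u v g : 'rV[A]_3) :
  dot u g = 0 -> dot v g = 0 ->
  forall i j, cross u v 0 i * g 0 j = cross u v 0 j * g 0 i.
Proof. by move=> ug vg; apply: cross_eq0; rewrite cross_cross ug vg !scale0r subrr. Qed.

Lemma dot_cross_eq0 (A : idomainType) (u v w g : 'rV[A]_3) :
  g != 0 -> dot u g = 0 -> dot v g = 0 -> dot w g = 0 -> dot (cross u v) w = 0.
Proof.
move=> /row_neq0[i gi] ug vg wg; apply: (mulIf gi); rewrite mul0r.
rewrite /dot mulr_suml; under eq_bigr => j _ do
  rewrite mulrAC (cross_parallel ug vg j i) -mulrA [g 0 j * _]mulrC.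
by rewrite -mulr_sumr -/(dot w g) wg mulr0.
Qed.

(** For [g] the gradient of [f], this is a basis of the module of Jacobian
    syzygies of [f]. *)
Definition basis_of_orthogonal (A : idomainType) (g : 'rV[A]_3) (m : nat)
    (r : 'I_m -> 'rV[A]_3) : Prop :=
  [/\ forall j, dot (r j) g = 0,
      forall u, dot u g = 0 -> exists c, u = \sum_j c j *: r j
    & forall c, \sum_j c j *: r j = 0 -> forall j, c j = 0].

Lemma lin_indep3 (A : idomainType) (m : nat) (r : 'I_m -> 'rV[A]_3) (a b c : A)
    (i j k : 'I_m) :
    (forall c, \sum_j c j *: r j = 0 -> forall j, c j = 0) ->
    i != j -> i != k -> a *: r i + b *: r j + c *: r k = 0 -> a = 0.
Proof.
move=> free ij ik e.
have sumE x l : \sum_h (x *+ (h == l)) *: r h = x *: r l.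
  rewrite (bigD1 l) //= eqxx big1 ?addr0 // => h /negbTE->.
  by rewrite scale0r.
have := free (fun h => a *+ (h == i) + b *+ (h == j) + c *+ (h == k)).
under eq_bigr => h _ do rewrite !scalerDl.
rewrite !big_split !sumE => /(_ e i).
by rewrite eqxx (negbTE ij) (negbTE ik) !addr0.
Qed.

(** Three vectors orthogonal to [g] have determinant zero, so Cramer's rule is a
    linear relation between them; its coefficients being zero makes [r b]
    and [r c] proportional, which again contradicts independence. *)
Lemma basis_size_le2 (A : idomainType) (g : 'rV[A]_3) (m : nat) (r : 'I_m -> 'rV[A]_3) :
  g != 0 -> basis_of_orthogonal g r -> (m <= 2)%N.
Proof.
move=> g0 [rg _ free]; rewrite leqNgt; apply/negP => m3.
pose a := Ordinal (ltnW (ltnW m3)); pose b := Ordinal (ltnW m3); pose c := Ordinal m3.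
have bc0 i : cross (r b) (r c) 0 i = 0.
  apply: (lin_indep3 (r := r) (i := a) (j := b) (k := c)
    (b := cross (r c) (r a) 0 i) (c := cross (r a) (r b) 0 i)) => //.
  by rewrite cramer3 (dot_cross_eq0 g0) ?scale0r //.
have {}bc0 : cross (r b) (r c) = 0 by apply/rowP => i; rewrite bc0 mxE.
have rb0 : r b = 0.
  apply/rowP => i; rewrite mxE.
  apply: (lin_indep3 (r := r) (i := c) (j := b) (k := a) (b := - r c 0 i) (c := 0)) => //.
  rewrite scale0r addr0; apply/rowP => j; rewrite !mxE.
  by rewrite (cross_eq0 bc0 i j); ring.
have /eqP : (1 : A) = 0.
  apply: (lin_indep3 (r := r) (i := b) (j := a) (k := c) (b := 0) (c := 0)) => //.
  by rewrite rb0 scaler0 !scale0r !addr0.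
by rewrite oner_eq0.
Qed.

(** Saito's criterion. Writing Koszul relations in the basis shows that
    the cross product [w] of the two basis vectors divides [g_i g] for every
    [i]; conversely [w = h g] because [w] is proportional to the primitive
    vector [g]. So [h] divides every [g_i], and is a unit. *)
Lemma saito_criterion (A : idomainType) (g : 'rV[A]_3) (m : nat) (r : 'I_m -> 'rV[A]_3) :
    ufd A -> (forall p, prime_elt p -> ~ forall i, divides p (g 0 i)) ->
    g != 0 -> basis_of_orthogonal g r ->
  exists u v h, [/\ dot u g = 0, dot v g = 0, h \is a GRing.unit
    & cross u v = h *: g].
Proof.
move=> HA prim g0 rB; have := basis_size_le2 g0 rB; case: rB => rg span _.
have [i0 gi0] := row_neq0 g0.
have koszul i : exists u v, [/\ dot u g = 0, dot v g = 0 & cross u v = g 0 i *: g].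
  have [a [b ab]] := cross_delta A i; exists (cross a g), (cross b g).
  by rewrite !dot_cross_self cross_koszul ab dot_delta.
case: m r rg span => [|[|[|//]]] r rg span _.
- have [u [v [/span[c uE] _]]] := koszul i0.
  rewrite uE big_ord0 cross0l => /rowP/(_ i0)/esym/eqP; rewrite !mxE.
  by rewrite mulf_eq0 orbb (negPf gi0).
- have [u [v [/span[c uE] /span[e vE]]]] := koszul i0.
  rewrite uE vE !big_ord1 crossZl crossZr crossvv !scaler0 => /rowP/(_ i0)/esym/eqP.
  by rewrite !mxE mulf_eq0 orbb (negPf gi0).
pose w := cross (r 0) (r 1).
have [h wE] : exists h, forall i, w 0 i = h * g 0 i.
  apply: (primitive_divides (a := g 0 i0) (b := w 0 i0) HA prim gi0) => i.
  by rewrite mulrC; apply: cross_parallel.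
have {wE} wE : w = h *: g by apply/rowP => i; rewrite wE mxE.
have hg i : divides h (g 0 i).
  have [u [v [/span[c ->] /span[e ->]]]] := koszul i.
  rewrite !big_ord_recl !big_ord0 !addr0.
  rewrite (_ : lift ord0 ord0 = 1); last exact: val_inj.
  rewrite -[ord0]/(0 : 'I_2).
  rewrite crossDl !crossDr !crossZl !crossZr !crossvv [cross (r 1) _]crossC -/w wE.
  move=> /rowP/(_ i0); rewrite !mxE => e0.
  exists (c 0 * e 1 - c 1 * e 0); apply: (mulIf gi0); rewrite -e0; ring.
exists (r 0), (r 1), h; split=> //; apply: contrapT => /negP Nh.
have h0 : h != 0.
  by apply: contraNneq gi0 => h0; have [c ->] := hg i0; rewrite h0 mul0r.
have [p pP [c hE]] := ufd_prime_divisor HA h0 Nh.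
by apply: (prim p pP) => i; have [e ->] := hg i; exists (c * e); rewrite hE mulrA.
Qed.

Definition hcomp (A : comNzRingType) (n N : nat) (k : nat) (u : 'rV[{mpoly A[n]}]_N) :
  'rV[{mpoly A[n]}]_N := \row_i pihomog mdeg k (u 0 i).

Lemma hcomp_graded (A : comNzRingType) (n N : nat) (k : nat) (u : 'rV[{mpoly A[n]}]_N) :
  graded_vec k (hcomp k u).
Proof. by move=> i; rewrite mxE pihomogP. Qed.

Lemma hcomp_sum (A : comNzRingType) (n N : nat) (u : 'rV[{mpoly A[n]}]_N) :
  exists K, u = \sum_(k < K) hcomp k u.
Proof.
exists (\max_i msize (u 0%R i))%N; apply/rowP => i; rewrite summxE.
rewrite [LHS](@pihomog_partitionE _ _ mdeg (\max_i msize (u 0%R i))%N); last first.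
  exact: (leq_bigmax_cond (F := fun i => msize (u 0 i))).
by apply: eq_bigr => k _; rewrite mxE.
Qed.

Lemma cross_graded (A : comNzRingType) (n k l : nat) (u v : 'rV[{mpoly A[n]}]_3) :
  graded_vec k u -> graded_vec l v -> graded_vec (k + l) (cross u v).
Proof.
by move=> hu hv; apply: forall_ord3; rewrite crossE rpredB ?dhomogM // addnC dhomogM.
Qed.

Lemma dot_hcomp (A : comNzRingType) (n k e : nat) (u g : 'rV[{mpoly A[n]}]_3) :
  graded_vec e g -> dot u g = 0 -> dot (hcomp k u) g = 0.
Proof.
move=> hg ug; have := congr1 (pihomog mdeg (k + e)) ug.
rewrite raddf0 /dot raddf_sum /= => e0; rewrite -[RHS]e0.
by apply: eq_bigr => i _; rewrite mxE (pihomogM_homog _ _ (hg i)) leq_addl addnK.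
Qed.

(** The part of degree [d] of a cross product is the sum of the cross products
    of components of degrees [k] and [l] with [k + l = d], so one of these is
    nonzero. *)
Lemma cross_components (A : comNzRingType) (n d : nat) (u v : 'rV[{mpoly A[n]}]_3) :
  graded_vec d (cross u v) -> cross u v != 0 ->
  exists k l, (k + l)%N = d /\ cross (hcomp k u) (hcomp l v) != 0.
Proof.
move=> hw w0; apply: contrapT => H; case/eqP: w0.
have [K uE] := hcomp_sum u; have [L vE] := hcomp_sum v.
apply/rowP => i; rewrite -(pihomog_dE (hw i)) [in LHS]uE [in LHS]vE cross_suml.
rewrite summxE raddf_sum mxE big1 //= => k _.
rewrite cross_sumr summxE raddf_sum big1 //= => l _.
have [kl|kl] := eqVneq (k + l)%N d; last first.
  by apply: pihomog_ne0 kl _; apply: cross_graded; apply: hcomp_graded.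
have [->|nz] := eqVneq (cross (hcomp k u) (hcomp l v)) 0; first by rewrite mxE raddf0.
by case: H; exists k, l.
Qed.

(** * Syzygies of a plane curve and of a union *)

Definition grad (A : comNzRingType) (n : nat) (f : {mpoly A[n]}) : 'rV[{mpoly A[n]}]_n :=
  \row_i f^`M(i).

Definition euler (A : comNzRingType) (n : nat) : 'rV[{mpoly A[n]}]_n := \row_i 'X_i.

Lemma dotC (A : comNzRingType) (u v : 'rV[A]_3) : dot u v = dot v u.
Proof. by rewrite !dotE; ring. Qed.

Lemma dot_euler_grad (A : comNzRingType) (d : nat) (f : {mpoly A[3]}) :
  f \is d.-homog -> dot (euler A 3) (grad f) = f *+ d.
Proof.
by move/euler_formula <-; apply: eq_bigr => i _; rewrite !mxE.
Qed.

Lemma grad_graded (A : comNzRingType) (n d : nat) (f : {mpoly A[n]}) :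
  f \is d.-homog -> graded_vec d.-1 (grad f).
Proof. by move=> hf i; rewrite mxE dhomog_mderiv. Qed.

Lemma mpoly_natr_unit (K : numFieldType) (n d : nat) :
  (0 < d)%N -> (d%:R : {mpoly K[n]}) \is a GRing.unit.
Proof. by move=> d0; rewrite -mpolyC_nat rmorph_unit // unitfE pnatr_eq0 -lt0n. Qed.

Lemma grad_neq0 (K : numFieldType) (d : nat) (f : {mpoly K[3]}) :
  (0 < d)%N -> f != 0 -> f \is d.-homog -> grad f != 0.
Proof.
move=> d0 f0 hf; apply: contraNneq f0 => g0.
have := dot_euler_grad hf; rewrite g0 dotE !mxE !mulr0 !addr0 -mulr_natl => /esym/eqP.
by rewrite mulrI_eq0 //; apply/mulrI/mpoly_natr_unit.
Qed.

(** A prime [p] that divides all the derivatives divides [f] by Euler's formula,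
    say [f = p w], and then it divides [w] times every derivative of [p]. It does
    not divide [w], as [f] is squarefree; so it divides its own derivatives, which
    have smaller degree. They vanish, and [p] is constant. *)
Lemma gradient_primitive (K : numFieldType) (d : nat) (f p : {mpoly K[3]}) :
    (0 < d)%N -> f != 0 -> f \is d.-homog ->
    (forall g, divides (g ^+ 2) f -> (msize g <= 1)%N) ->
  prime_elt p -> ~ forall i, divides p (grad f 0 i).
Proof.
move=> d0 f0 hf sqf pP pf; have [p0 _ Hp] := pP.
have p1 := msize_prime pP.
have [w fE] : divides p f.
  have : divides p (f *+ d).
    rewrite -(dot_euler_grad hf) /dot; apply: (big_ind (divides p)) => [|x y [a ->] [b ->]|i _].
    - by exists 0; rewrite mulr0.
    - by exists (a + b); rewrite mulrDr.
    by apply: divides_mull.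
  by rewrite -mulr_natl => /Hp[/(prime_ndivides_unit pP)[]|//]; apply: mpoly_natr_unit.
have w0 : w != 0 by apply: contraNneq f0 => w0; rewrite fE w0 mulr0.
have Npw : ~ divides p w.
  move=> [v wE]; have : (msize p <= 1)%N.
    by apply: sqf; exists v; rewrite fE wE mulrA.
  by rewrite leqNgt p1.
suff /mderiv_eq0 : forall i, p^`M(i) = 0 by rewrite leqNgt p1.
move=> i; apply/eqP; apply: contraT => pi0.
have [pi|//] : divides p p^`M(i) \/ divides p w; last first.
  by have := msize_divides pi0 pi; rewrite leqNgt msize_mderiv.
apply: Hp; have [a aE] := pf i; exists (a - w^`M(i)).
by rewrite mulrBr -aE mxE fE mderivM addrK.
Qed.

(** Saito's criterion gives a basis whose cross product is a
    scalar multiple of the gradient. The basis need not be homogeneous, but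
    suitable homogeneous components of its two elements are as good. *)
Lemma free_syzygies (K : numFieldType) (d m : nat) (f : {mpoly K[3]})
    (r : 'I_m -> 'rV[{mpoly K[3]}]_3) :
    (0 < d)%N -> f != 0 -> f \is d.-homog ->
    (forall g, divides (g ^+ 2) f -> (msize g <= 1)%N) ->
    basis_of_orthogonal (grad f) r ->
  exists k l u v, [/\ dot u (grad f) = 0 /\ dot v (grad f) = 0,
    graded_vec k u /\ graded_vec l v, (k + l)%N = d.-1 & cross u v != 0].
Proof.
move=> d0 f0 hf sqf rB.
have g0 := grad_neq0 d0 f0 hf; have hg := grad_graded hf.
have [u [v [h [ug vg Uh w]]]] := saito_criterion (@ufd_mpoly _ 3)
    (fun p pP => gradient_primitive d0 f0 hf sqf pP) g0 rB.
have h0 : h != 0 by apply: contraTneq Uh => ->; rewrite unitr0.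
have hw : graded_vec d.-1 (cross u v).
  rewrite w => i; rewrite mxE -[d.-1]add0n; apply: dhomogM; last exact: hg.
  move: Uh; rewrite mpoly_unitE => /msize_poly1P[c _ ->].
  by rewrite -[c%:MP]mulr1 mul_mpolyC rpredZ // dhomog1.
have w0 : cross u v != 0.
  have [i gi] := row_neq0 g0; apply: contraNneq gi => e.
  by have /rowP/(_ i)/eqP := w; rewrite e !mxE eq_sym mulf_eq0 (negPf h0).
have [k [l [kl nz]]] := cross_components hw w0.
exists k, l, (hcomp k u), (hcomp l v); split=> //.
- by split; apply: dot_hcomp hg _.
- by split; apply: hcomp_graded.
Qed.

Definition generates (A : comNzRingType) (N m : nat) (M : 'rV[A]_N -> Prop)
    (r : 'I_m -> 'rV[A]_N) (B : {set 'I_m}) : Prop :=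
  (forall j, j \in B -> M (r j)) /\
  forall u, M u -> exists c : 'I_m -> A, u = \sum_(j in B) c j *: r j.

Definition graded_minimal_generators (A : comNzRingType) (n N m : nat)
    (M : 'rV[{mpoly A[n]}]_N -> Prop) (r : 'I_m -> 'rV[{mpoly A[n]}]_N)
    (e : 'I_m -> nat) : Prop :=
  [/\ forall j, graded_vec (e j) (r j), generates M r [set: 'I_m]
    & forall B : {set 'I_m}, generates M r B -> B = [set: 'I_m]].

(** Of the coefficients of a homogeneous element only the components of the
    complementary degrees matter, and those at generators of too large a degree
    are zero. *)
Lemma generates_low (A : comNzRingType) (n N m : nat) (M : 'rV[{mpoly A[n]}]_N -> Prop)
    (r : 'I_m -> 'rV[{mpoly A[n]}]_N) (e : 'I_m -> nat) k u :
    generates M r [set: 'I_m] -> (forall j, graded_vec (e j) (r j)) ->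
    M u -> graded_vec k u ->
  exists c : 'I_m -> {mpoly A[n]}, u = \sum_(j | (e j <= k)%N) c j *: r j.
Proof.
move=> [_ gen] hr /gen[c uE] hu.
exists (fun j => pihomog mdeg (k - e j) (c j)).
apply/rowP => i; rewrite -(pihomog_dE (hu i)) uE !summxE raddf_sum /= [RHS]big_mkcond.
apply: eq_big => j; rewrite ?inE // => _.
by rewrite mxE (pihomogM_homog _ _ (hr j i)); case: ifP => //; rewrite mxE.
Qed.

Lemma generator_irredundant (A : comNzRingType) (N m : nat) (M : 'rV[A]_N -> Prop)
    (r : 'I_m -> 'rV[A]_N) j (c : 'I_m -> A) :
    generates M r [set: 'I_m] ->
    (forall B : {set 'I_m}, generates M r B -> B = [set: 'I_m]) ->
  r j <> \sum_(k | k != j) c k *: r k.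
Proof.
move=> [rM gen] min rj.
suff /min/setP/(_ j) : generates M r [set~ j] by rewrite !inE eqxx.
split=> [k _|u /gen[a uE]]; first by apply: rM; rewrite inE.
exists (fun k => a j * c k + a k); rewrite uE.
under [RHS]eq_bigr => k _ do rewrite scalerDl -scalerA.
rewrite big_split -scaler_sumr (bigD1 j) ?inE //= {1}rj.
by congr (_ *: _ + _); apply: eq_bigl => k; rewrite !inE.
Qed.

(** The first generator is primitive, since dividing it by a common factor of its
    entries would give an element of smaller degree. So if the second one were
    proportional to it, it would be a multiple of it, hence redundant. *)
Lemma first_generators_independent (K : fieldType) (n m : nat)
    (M : 'rV[{mpoly K[n]}]_3 -> Prop)
    (r : 'I_m.+2 -> 'rV[{mpoly K[n]}]_3) (e : 'I_m.+2 -> nat) :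
    (forall p u, p != 0 -> M (p *: u) -> M u) ->
    graded_minimal_generators M r e ->
    (forall j k : 'I_m.+2, (j <= k)%N -> (e j <= e k)%N) ->
  cross (r 0) (r 1) != 0.
Proof.
move=> satM rmin emon; have [hr gen min] := rmin.
have irr j c := generator_irredundant (j := j) (c := c) gen min.
have r0 : r 0 != 0.
  apply/eqP => r0; apply: (irr 0 (fun _ => 0)); rewrite r0 big1 // => k _.
  by rewrite scale0r.
have rM j : M (r j) by case: gen => rM _; apply: rM; rewrite inE.
have prim p : prime_elt p -> ~ forall i, divides p (r 0 0 i).
  move=> pP /choice[v vE]; have [p0 _ _] := pP.
  have rE : r 0 = p *: \row_i v i by apply/rowP => i; rewrite !mxE vE.
  have hv : graded_vec (e 0%R - (msize p).-1) (\row_i v i).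
    move=> i; rewrite mxE; have [->|vi] := eqVneq (v i) 0; first exact: rpred0.
    have := hr 0 i; rewrite vE => /(dhomog_factor p0 vi)[_ hv <-].
    by rewrite addKn.
  have pe : ((msize p).-1 <= e 0%R)%N.
    have [i ri] := row_neq0 r0; have := hr 0 i; rewrite vE => /dhomog_factor[] //.
      by apply: contraNneq ri => vi; rewrite vE vi mulr0.
    by move=> _ _ <-; rewrite leq_addr.
  have Mv : M (\row_i v i) by apply: (satM p) => //; rewrite -rE.
  have p1 : (0 < (msize p).-1)%N by rewrite -subn1 subn_gt0 msize_prime.
  have [c] := generates_low gen hr Mv hv.
  rewrite big1 => [v0|j]; first by case/eqP: r0; rewrite rE v0 scaler0.
  rewrite leqNgt => /negP[]; apply: leq_trans (emon 0 j _) => //.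
  by rewrite ltn_subrL p1 (leq_trans p1 pe).
apply/eqP => /cross_eq0 par; have [i ri] := row_neq0 r0.
have [h hE] : exists h, forall j, r 1 0 j = h * r 0 0 j.
  apply: (primitive_divides (a := r 0 0 i) (b := r 1 0 i) (@ufd_mpoly _ n) prim ri) => j.
  by rewrite par mulrC.
apply: (irr 1 (fun k => h *+ (k == 0))).
rewrite (bigD1 0) //= big1 ?addr0 => [|k /andP[_ /negbTE->]]; last by rewrite scale0r.
by apply/rowP => j; rewrite mxE hE.
Qed.

(** Two independent elements cannot both be multiples of the first generator, so the
    second generator has at most the larger of their degrees. *)
Lemma first_degrees_le (A : comNzRingType) (n m : nat)
    (M : 'rV[{mpoly A[n]}]_3 -> Prop)
    (r : 'I_m.+2 -> 'rV[{mpoly A[n]}]_3) (e : 'I_m.+2 -> nat) k l u v :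
    graded_minimal_generators M r e ->
    (forall j k : 'I_m.+2, (j <= k)%N -> (e j <= e k)%N) ->
    M u -> M v -> graded_vec k u -> graded_vec l v -> cross u v != 0 ->
  (e 0%R + e 1%R <= k + l)%N.
Proof.
move=> [hr gen _] emon; wlog kl : k l u v / (k <= l)%N.
  move=> H uM vM hu hv; have [kl|/ltnW lk] := leqP k l.
    exact: H kl uM vM hu hv.
  by rewrite (crossC_eq0 v u) (addnC k); exact: H lk vM uM hv hu.
move=> uM vM hu hv w0; apply: leq_add.
  rewrite leqNgt; apply: contra w0 => ek.
  have [c ->] := generates_low gen hr uM hu; rewrite big1 ?cross0l // => j.
  by rewrite leqNgt (leq_trans ek) // emon.
rewrite leqNgt; apply: contra w0 => el.
have first t x : (t <= l)%N -> M x -> graded_vec t x -> exists c, x = c *: r 0.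
  move=> tl xM hx; have [c ->] := generates_low gen hr xM hx.
  exists (if (e 0%R <= t)%N then c 0 else 0); rewrite big_mkcond (bigD1 0) //=.
  rewrite big1 ?addr0 => [|j j0]; first by case: ifP => //; rewrite scale0r.
  rewrite leqNgt (leq_trans (leq_ltn_trans tl el)) // emon //.
  by rewrite lt0n.
have [a ->] := first k u kl uM hu; have [b ->] := first l v (leqnn l) vM hv.
by rewrite crossZl crossZr crossvv !scaler0.
Qed.

Lemma spanned_comb (A : comNzRingType) (N m : nat) (r : 'I_m -> 'rV[A]_N) (B : {set 'I_m}) u :
  spanned [seq r j | j in B] u <-> exists c : 'I_m -> A, u = \sum_(j in B) c j *: r j.
Proof.
split=> [sp|[c ->]]; last first.
  apply: (submodule_sum _ (spanned_submodule _)) => j jB.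
  apply: (submoduleZ _ (spanned_submodule _)); apply: spanned_mem.
  exact: image_f.
apply: (sp (fun w => exists c : 'I_m -> A, w = \sum_(j in B) c j *: r j))
  => [|_ /imageP[j jB ->]].
  split=> [|a x y [c ->] [d ->]].
    by exists (fun=> 0); rewrite big1 // => j _; rewrite scale0r.
  exists (fun j => a * c j + d j); rewrite scaler_sumr -big_split /=.
  by apply: eq_bigr => j _; rewrite scalerDl scalerA.
exists (fun k => (k == j)%:R).
rewrite (bigD1 j) //= eqxx scale1r big1 ?addr0 // => k /andP[_ /negbTE->].
by rewrite scale0r.
Qed.

(** A system of homogeneous generators with the least number of elements is
    minimal, and two independent elements force it to have at least two
    elements. *)
Lemma minimal_generators_exist (K : fieldType) (n : nat)
    (M : 'rV[{mpoly K[n]}]_3 -> Prop) u v :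
    submodule M -> (forall k w, M w -> M (hcomp k w)) ->
    M u -> M v -> cross u v != 0 ->
  exists (m : nat) (r : 'I_m.+2 -> 'rV[{mpoly K[n]}]_3) (e : 'I_m.+2 -> nat),
    graded_minimal_generators M r e /\
    forall j k : 'I_m.+2, (j <= k)%N -> (e j <= e k)%N.
Proof.
move=> subM gradM uM vM w0.
pose P b := exists s : seq ('rV[{mpoly K[n]}]_3 * nat), [/\ size s = b,
  {in s, forall x, M x.1 /\ graded_vec x.2 x.1}
  & forall w, M w -> spanned (map fst s) w].
have exP : exists b, `[< P b >].
  have [s [sM sgen]] := graded_hilbert_basis subM.
  have /choice[e eP] : forall x : 'rV[{mpoly K[n]}]_3, exists k, x \in s -> graded_vec k x.
    move=> x; have [xs|//] := boolP (x \in s); last by exists 0%N.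
    by have [_ [k hk]] := sM x xs; exists k.
  exists (size s); apply/asboolP; exists [seq (x, e x) | x <- s]; split.
  - by rewrite size_map.
  - by move=> _ /mapP[x xs ->] /=; split; [case: (sM x xs) | apply: eP].
  rewrite -map_comp map_id => w wM; have [b ->] := hcomp_sum w.
  apply: (submodule_sum _ (spanned_submodule _)) => k _.
  by apply: (sgen k); [apply: gradM | apply: hcomp_graded].
case: (ex_minnP exP) => b /asboolP[s0 [s0b s0M s0gen]] bmin.
pose le2 (x y : 'rV[{mpoly K[n]}]_3 * nat) := (x.2 <= y.2)%N.
pose s := sort le2 s0.
have sb : size s = b by rewrite size_sort.
have sM : {in s, forall x, M x.1 /\ graded_vec x.2 x.1}.
  by move=> x; rewrite mem_sort => /s0M.
have sgen w : M w -> spanned (map fst s) w.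
  move/s0gen; apply: spanned_sub => x /mapP[y ys ->].
  by apply: map_f; rewrite mem_sort.
pose x0 : 'rV[{mpoly K[n]}]_3 * nat := (0, 0%N).
pose r (j : 'I_b) := (nth x0 s j).1; pose e (j : 'I_b) := (nth x0 s j).2.
have js (j : 'I_b) : nth x0 s j \in s by rewrite mem_nth ?sb.
have genE w : M w -> exists c : 'I_b -> _, w = \sum_(j in [set: 'I_b]) c j *: r j.
  move/sgen => sp; apply/spanned_comb.
  apply: spanned_sub sp => _ /mapP[x /(nthP x0)[k ks <-] ->].
  rewrite sb in ks; apply/imageP; exists (Ordinal ks).
    by rewrite in_setT.
  by [].
have gen : generates M r [set: 'I_b].
  by split=> [j _|//]; case: (sM _ (js j)).
have rmin : graded_minimal_generators M r e.
  split=> // [j|B [_ Bgen]]; first by case: (sM _ (js j)).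
  apply/eqP; rewrite eqEcard subsetT cardsT card_ord; apply: bmin; apply/asboolP.
  exists [seq (r j, e j) | j in B]; split.
  - by rewrite size_image.
  - by move=> _ /imageP[j _ ->]; apply: sM (js j).
  by move=> w /Bgen/spanned_comb; rewrite -map_comp.
have emon (j k : 'I_b) : (j <= k)%N -> (e j <= e k)%N.
  move=> jk; apply: (sorted_leq_nth (leT := le2)) => //.
  - by move=> x y z; apply: leq_trans.
  - by move=> x; apply: leqnn.
  - by apply: sort_sorted => x y; apply: leq_total.
  - by rewrite inE sb.
  - by rewrite inE sb.
clearbody e r; clear bmin s0b sb js genE.
case: b r e gen rmin emon => [|[|m]] r e [_ gen] rmin emon.
- have [c uE] := gen u uM; case/eqP: w0.
  by rewrite uE big1 ?cross0l // => -[].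
- have [c uE] := gen u uM; have [a vE] := gen v vM; case/eqP: w0.
  rewrite uE vE !(big_pred1 ord0) => [|j|j]; try by rewrite inE (ord1 j).
  by rewrite crossZl crossZr crossvv !scaler0.
by exists m, r, e.
Qed.

(** As a derivation, [g *: u] kills [f] and maps [g] to a multiple of [g]. The
    Euler derivation multiplies [f * g] by [d + e], so that a multiple of it
    corrects the value at [f * g] to zero. *)
Lemma union_syzygy (K : numFieldType) (d e k : nat) (f g : {mpoly K[3]}) u :
    (0 < d)%N -> f \is d.-homog -> g \is e.-homog ->
    dot u (grad f) = 0 -> graded_vec k u ->
  exists a, dot (g *: u + a *: euler K 3) (grad (f * g)) = 0 /\
    graded_vec (k + e) (g *: u + a *: euler K 3).
Proof.
move=> d0 hf hg uf hu.
have de : (d + e)%:R != 0 :> K by rewrite pnatr_eq0 -lt0n addn_gt0 d0.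
exists (- (((d + e)%:R^-1)%:MP * dot u (grad g))); split.
  have gradM : grad (f * g) = f *: grad g + g *: grad f.
    by apply/rowP => i; rewrite !mxE mderivM addrC [g * _]mulrC.
  have hfg : f * g \is (d + e).-homog by apply: dhomogM.
  rewrite dotDl !dotZl (dot_euler_grad hfg) gradM [dot u _]dotC dotDl !dotZl.
  rewrite [dot (grad f) u]dotC uf mulr0 addr0 [dot (grad g) u]dotC.
  rewrite -(mulr_natl (f * g)) -mpolyC_nat mulNr.
  have ee : ((d + e)%:R^-1)%:MP * ((d + e)%:R)%:MP = 1 :> {mpoly K[3]}.
    by rewrite -mpolyCM mulVf.
  move: ee; move: (_%:MP) => c; move: (_%:MP) => n ee.
  have -> : c * dot u (grad g) * (n * (f * g)) = (c * n) * (dot u (grad g) * (f * g)) by ring.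
  by rewrite ee; ring.
move=> i; rewrite !mxE rpredD //; first by rewrite addnC; apply: dhomogM.
have [e0|e0] := posnP e.
  have gg0 : grad g = 0.
    apply/rowP => j; rewrite !mxE; move: hg; rewrite e0 => hg.
    have -> : g = (g@_0)%:MP.
      apply/msize1_polyC; have [->|g0] := eqVneq g 0; first by rewrite msize0.
      by have /= := dhomog_mf hg (mlead_supp g0); rewrite -mlead_deg // => ->.
    by rewrite mderivC.
  by rewrite gg0 dotE !mxE !mulr0 !addr0 mulr0 oppr0 mul0r rpred0.
rewrite mulNr rpredN -mulrA mul_mpolyC rpredZ //.
rewrite (_ : (k + e)%N = (k + e.-1 + 1)%N); last by rewrite addn1 -addnS prednK.
apply: dhomogM; last by rewrite dhomogX /= mdeg1.
apply: rpred_sum => j _; apply: dhomogM; first exact: hu.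
exact: grad_graded.
Qed.

(** The determinant of [u], [v] and the Euler vector [E] is not affected by
    adding multiples of [E]. It is nonzero because [cross u v] is proportional
    to the gradient of [f], whose product with [E] is [d f]. *)
Lemma union_cross_neq0 (K : numFieldType) (d : nat) (f g a b : {mpoly K[3]}) u v :
    (0 < d)%N -> f != 0 -> f \is d.-homog -> g != 0 ->
    dot u (grad f) = 0 -> dot v (grad f) = 0 -> cross u v != 0 ->
  cross (g *: u + a *: euler K 3) (g *: v + b *: euler K 3) != 0.
Proof.
move=> d0 f0 hf g0 uf vf /row_neq0[i wi].
have : cross u v 0 i * (d%:R * f) = grad f 0 i * dot (cross u v) (euler K 3).
  rewrite mulr_natl -(dot_euler_grad hf) [dot (euler K 3) _]dotC /dot !mulr_sumr.
  apply: eq_bigr => j _.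
  by rewrite mulrA (cross_parallel uf vf) [RHS]mulrA [grad f 0 i * _]mulrC.
move: (euler K 3) => E wE.
suff : dot (cross (g *: u + a *: E) (g *: v + b *: E)) E != 0.
  by apply: contraNneq => ->; rewrite dotE !mxE !mul0r !addr0.
rewrite dot_cross_shift mulf_neq0 ?expf_neq0 //; apply: contraNneq wi => w0; move: wE.
rewrite w0 mulr0 => /eqP; rewrite !mulf_eq0 (negPf f0) orbF => /orP[//|].
by have := @mpoly_natr_unit K 3 _ d0 => /[swap] /eqP ->; rewrite unitr0.
Qed.

(** * Reducedness of a union, and the theorem *)

Lemma prime_sq_cancel (A : idomainType) (p f g : A) :
  prime_elt p -> ~ divides p g -> divides (p ^+ 2) (f * g) -> divides (p ^+ 2) f.
Proof.
move=> [p0 _ Hp] Ng [c cE].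
have [|[f' fE]|//] := Hp f g; first by exists (p * c); rewrite cE expr2 mulrA.
have [|[f'' f'E]|//] := Hp f' g; last by exists f''; rewrite fE f'E expr2 mulrA.
by exists c; apply: (mulfI p0); rewrite !mulrA -fE cE expr2.
Qed.

(** If [h ^+ 2] divides [f * g], so does the square of a prime factor of [h];
    this prime divides only one of [f] and [g], and its square divides that one. *)
Lemma squarefree_mul (K : fieldType) (n : nat) (f g : {mpoly K[n]}) :
    f != 0 -> g != 0 ->
    (forall h, divides (h ^+ 2) f -> (msize h <= 1)%N) ->
    (forall h, divides (h ^+ 2) g -> (msize h <= 1)%N) ->
    (forall p, prime_elt p -> divides p f -> ~ divides p g) ->
  forall h, divides (h ^+ 2) (f * g) -> (msize h <= 1)%N.
Proof.
move=> f0 g0 sf sg fg h [c cE]; have fg0 : f * g != 0 by rewrite mulf_neq0.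
have h0 : h != 0 by apply: contraNneq fg0 => h0; rewrite cE h0 expr0n mul0r.
rewrite leqNgt; apply/negP => h1.
have Nh : h \isn't a GRing.unit by rewrite mpoly_unitE; case: eqP h1 => // ->.
have [p pP [k hE]] := ufd_prime_divisor (@ufd_mpoly K n) h0 Nh.
have p2 : divides (p ^+ 2) (f * g) by exists (k ^+ 2 * c); rewrite cE hE exprMn mulrA.
have := msize_prime pP; rewrite ltnNge => /negP[].
have [pf|Npf] := pselect (divides p f).
  exact/sf/(prime_sq_cancel pP (fg p pP pf) p2).
by apply: sg; apply: (prime_sq_cancel pP Npf); rewrite mulrC.
Qed.

Lemma poly_vanishing (K : closedFieldType) (P : {poly K}) :
  (forall x, P.[x] = 0) -> P = 0.
Proof.
move=> P0; apply/eqP; apply: contraT => /closed_nonrootP[x].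
by rewrite /root P0 eqxx.
Qed.

(** A form in three variables restricts to a binary form on every projective
    line. If the dehomogenised restriction has no root, then it is constant, and
    the point at infinity of the line is a zero. *)
Lemma homog_zero_on_line (K : closedFieldType) (k : nat) (p : {mpoly K[3]}) (a b : 'I_3 -> K) :
    (0 < k)%N -> p \is k.-homog ->
  exists x y, (x != 0 \/ y != 0) /\ p.@[fun i => x * a i + y * b i] = 0.
Proof.
move=> k0 hp.
pose restr (h : 'I_3 -> {poly K}) : {poly K} := mmap polyC h p.
have restrE h t : (restr h).[t] = p.@[fun i => (h i).[t]].
  rewrite mevalE /restr /mmap horner_sum; apply: eq_bigr => m _.
  rewrite hornerM hornerC /mmap1 horner_prod; congr (_ * _).
  by apply: eq_bigr => i _; rewrite horner_exp.
(* The restrictions to the two affine charts of the line. *)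
pose P := restr (fun i => (a i)%:P + b i *: 'X).
pose Q := restr (fun i => a i *: 'X + (b i)%:P).
have PE t : P.[t] = p.@[fun i => a i + t * b i].
  by rewrite restrE; apply: meval_eq => i; rewrite !hornerE mulrC.
have QE t : Q.[t] = p.@[fun i => t * a i + b i].
  by rewrite restrE; apply: meval_eq => i; rewrite !hornerE mulrC.
have [/eqP/size_poly1P[c c0 Pc]|/closed_rootP[t /eqP Pt]] := eqVneq (size P) 1%N; last first.
  exists 1, t; split; first by left; rewrite oner_eq0.
  by rewrite -[RHS]Pt PE; apply: meval_eq => i; rewrite mul1r.
(* On the overlap of the charts [Q] is [c t ^ k]; the factor ['X] takes care of
   the point where [t] is zero. *)
have QX : (Q - c *: 'X^k) * 'X = 0.
  apply: poly_vanishing => t; rewrite !hornerE.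
  have [->|t0] := eqVneq t 0; first by rewrite mulr0.
  rewrite (_ : Q.[t] = c * t ^+ k) ?subrr ?mul0r //.
  have := PE t^-1; rewrite Pc hornerC QE mulrC => ->.
  rewrite -(meval_homog _ _ hp); apply: meval_eq => i.
  by rewrite mulrDr mulVKf.
exists 0, 1; split; first by right; rewrite oner_eq0.
have : Q.[0] = 0.
  move/eqP: QX; rewrite mulf_eq0 polyX_eq0 orbF subr_eq0 => /eqP->.
  by rewrite hornerZ hornerXn expr0n gtn_eqF ?mulr0.
by move=> Q0; rewrite -[RHS]Q0 QE; apply: meval_eq => i; rewrite mul1r.
Qed.

(** The lines [x + t y + t^2 z = 0] form a family of which every point lies on at
    most two. *)
Lemma line_avoiding (K : closedFieldType) (s : seq 'rV[K]_3) :
  exists t, {in s, forall w : 'rV[K]_3, w != 0 -> w 0 0 + t * w 0 1 + t ^+ 2 * w 0 2 != 0}.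
Proof.
pose P : {poly K} := \prod_(w <- s | w != 0) ((w 0 0)%:P + w 0 1 *: 'X + w 0 2 *: 'X^2).
have : P != 0.
  rewrite prodf_seq_neq0; apply/allP => w _; apply/implyP => w0.
  apply: contraNneq w0 => e; apply/eqP/row3P; rewrite mxE.
  - have := congr1 (fun p : {poly K} => p`_0) e.
    by rewrite /= !(coefD, coefZ, coefC, coefX, coefXn) /= !mulr0 !addr0.
  - have := congr1 (fun p : {poly K} => p`_1) e.
    by rewrite /= !(coefD, coefZ, coefC, coefX, coefXn) /= mulr1 mulr0 add0r addr0.
  - have := congr1 (fun p : {poly K} => p`_2) e.
    by rewrite /= !(coefD, coefZ, coefC, coefX, coefXn) /= mulr1 mulr0 !add0r.
case/closed_nonrootP => t Pt; exists t => w ws w0.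
move: Pt; rewrite /root horner_prod prodf_seq_neq0 => /allP/(_ w ws)/implyP/(_ w0).
rewrite !hornerE.
by have -> : w 0 0 + t * w 0 1 + t ^+ 2 * w 0 2 = w 0 0 + w 0 1 * t + w 0 2 * t * t by ring.
Qed.

Lemma common_zero_avoiding (K : closedFieldType) (k : nat) (p : {mpoly K[3]}) (s : seq 'rV[K]_3) :
    (0 < k)%N -> p \is k.-homog ->
  exists v : 'rV[K]_3, [/\ v != 0, p.@[v 0] = 0
    & {in s, forall w : 'rV[K]_3, forall c, v <> c *: w}].
Proof.
move=> k0 hp; have [t st] := line_avoiding s.
pose a (i : 'I_3) : K := [:: - t; 1; 0]`_i; pose b (i : 'I_3) : K := [:: - t ^+ 2; 0; 1]`_i.
have [x [y [xy pv]]] := homog_zero_on_line a b k0 hp.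
pose v : 'rV[K]_3 := \row_i (x * a i + y * b i).
have [v0E [v1E v2E]] : v 0 0 = x * - t + y * - t ^+ 2 /\ v 0 1 = x /\ v 0 2 = y.
  by rewrite !mxE /a /b /=; split; [|split]; ring.
have v0 : v != 0.
  apply/eqP => e; have vi i : v 0 i = 0 by rewrite e mxE.
  by case: xy => /eqP[]; [rewrite -v1E vi | rewrite -v2E vi].
exists v; split=> // [|w ws c vE].
  by rewrite -[RHS]pv; apply: meval_eq => i; rewrite mxE.
have w0 : w != 0 by apply: contraNneq v0 => w0; rewrite vE w0 scaler0.
have : c * (w 0 0 + t * w 0 1 + t ^+ 2 * w 0 2) = 0.
  have <- : v 0 0 + t * v 0 1 + t ^+ 2 * v 0 2 = 0 by rewrite v0E v1E v2E; ring.
  by rewrite vE !mxE; ring.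
move/eqP; rewrite mulf_eq0 (negPf (st w ws w0)) orbF => /eqP c0.
by case/eqP: v0; rewrite vE c0 scale0r.
Qed.

(** A common prime factor would be a form of positive degree, which has zeros
    outside any finite set of points. *)
Lemma finite_intersection_coprime (R : realType) (d : nat) (f g p : {mpoly R[i][3]}) :
    f != 0 -> f \is d.-homog -> finite_intersection f g ->
  prime_elt p -> divides p f -> ~ divides p g.
Proof.
move=> f0 hf [s sP] pP [f' fE] [g' gE]; have [p0 _ _] := pP.
have f'0 : f' != 0 by apply: contraNneq f0 => f'0; rewrite fE f'0 mulr0.
have hpf : p * f' \is d.-homog by rewrite -fE.
have [hp _ _] := dhomog_factor p0 f'0 hpf.
have k0 : (0 < (msize p).-1)%N by rewrite -subn1 subn_gt0 msize_prime.
have [v [v0 pv vs]] := common_zero_avoiding s k0 hp.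
have [||w ws [c vE]] := sP v v0; last exact: (vs w ws c).
- by rewrite fE mevalM pv mul0r.
- by rewrite gE mevalM pv mul0r.
Qed.

Lemma msize_homog (A : nzRingType) (n d : nat) (p : {mpoly A[n]}) :
  p != 0 -> p \is d.-homog -> msize p = d.+1.
Proof.
by move=> p0 hp; rewrite -mlead_deg //; have /= -> := dhomog_mf hp (mlead_supp p0).
Qed.

Lemma linear_form_irreducible (A : idomainType) (n : nat) (l a b : {mpoly A[n]}) :
  l != 0 -> l \is 1.-homog -> l = a * b -> (msize a <= 1)%N \/ (msize b <= 1)%N.
Proof.
move=> l0 hl lE; have := msize_homog l0 hl.
move: l0; rewrite lE mulf_eq0 negb_or => /andP[a0 b0]; rewrite msizeM //.
move: a0 b0; rewrite -!msize_poly_eq0.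
by case: (msize a) (msize b) => [|[|i]] [|[|j]] //; rewrite ?addSn ?addnS //; by [left|right].
Qed.

Lemma linear_form_squarefree (A : idomainType) (n : nat) (l g : {mpoly A[n]}) :
  l != 0 -> l \is 1.-homog -> divides (g ^+ 2) l -> (msize g <= 1)%N.
Proof.
move=> l0 hl [c]; rewrite expr2 -mulrA => lE.
have [//|] := linear_form_irreducible l0 hl lE; apply: leq_trans.
apply: msize_divides; last by exists c.
by apply: contraNneq l0 => gc0; rewrite lE gc0 mulr0.
Qed.

Lemma prime_divides_linear_form (K : fieldType) (n : nat) (l p f : {mpoly K[n]}) :
  l != 0 -> l \is 1.-homog -> prime_elt p -> divides p l -> divides p f ->
  divides l f.
Proof.
move=> l0 hl pP [b lE] [c fE].
have [|b1] := linear_form_irreducible l0 hl lE; first by rewrite leqNgt msize_prime.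
have Ub : b \is a GRing.unit.
  rewrite mpoly_unitE eqn_leq b1 lt0n msize_poly_eq0.
  by apply: contraNneq l0 => b0; rewrite lE b0 mulr0.
by exists (b^-1 * c); rewrite lE fE mulrA mulrK.
Qed.

Lemma D0E (R : realType) (f : {mpoly R[i][3]}) u : D0 f u <-> dot u (grad f) = 0.
Proof.
rewrite /D0 /dot; have -> // : \sum_(i < 3) u 0 i * f^`M(i) = \sum_i u 0 i * grad f 0 i.
by apply: eq_bigr => i _; rewrite mxE.
Qed.

Lemma D0_submodule (R : realType) (f : {mpoly R[i][3]}) : submodule (D0 f).
Proof.
split=> [|c u v /D0E uf /D0E vf]; apply/D0E.
  by rewrite dotC dotE !mxE !mulr0 !addr0.
by rewrite dotDl dotZl uf vf mulr0 addr0.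
Qed.

Lemma D0_hcomp (R : realType) (d k : nat) (f : {mpoly R[i][3]}) u :
  f \is d.-homog -> D0 f u -> D0 f (hcomp k u).
Proof.
by move=> /grad_graded hf /D0E uf; apply/D0E; apply: dot_hcomp hf uf.
Qed.

Lemma D0_saturated (R : realType) (f p : {mpoly R[i][3]}) u :
  p != 0 -> D0 f (p *: u) -> D0 f u.
Proof.
move=> p0 /D0E e; apply/D0E; apply: (mulfI p0).
by rewrite mulr0 -dotZl.
Qed.

(** Two independent syzygies of [f] of degrees [k] and [l] give two of [f * g] of
    degrees [k + e] and [l + e], and these bound the first two degrees of any
    minimal system of generators. *)
Lemma union_type_at_most (R : realType) (d e k l : nat) (f g : {mpoly R[i][3]}) u v (t : int) :
    (0 < d)%N -> f != 0 -> f \is d.-homog -> g != 0 -> g \is e.-homog ->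
    D0 f u -> D0 f v -> graded_vec k u -> graded_vec l v -> cross u v != 0 ->
    (k + l + e + 1)%N%:Z <= d%:Z + t ->
  type_at_most (d + e) (f * g) t.
Proof.
move=> d0 f0 hf g0 hg /D0E uD /D0E vD hu hv w0 kl.
have [a [aD ha]] := union_syzygy d0 hf hg uD hu.
have [b [bD hb]] := union_syzygy d0 hf hg vD hv.
have w0' := union_cross_neq0 a b d0 f0 hf g0 uD vD w0.
have hfg : f * g \is (d + e).-homog by apply: dhomogM.
have {}aD := (D0E _ _).2 aD; have {}bD := (D0E _ _).2 bD.
split.
  have [m [r [c [rmin cmon]]]] := minimal_generators_exist (D0_submodule _)
    (fun k w => D0_hcomp k hfg) aD bD w0'.
  by eexists; exists m, r, c.
move=> s [m [r [c [rmin cmon ->]]]].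
have := first_degrees_le rmin cmon aD bD ha hb w0'.
have -> : inord 0 = 0 :> 'I_m.+2 by apply: val_inj; rewrite /= inordK.
have -> : inord 1 = 1 :> 'I_m.+2 by apply: val_inj; rewrite /= inordK.
lia.
Qed.

Theorem corollary1p6 (R : realType) (d : nat) (f : {mpoly R[i][3]})
    (hf : reduced_curve d f) :
  (forall q : {mpoly R[i][3]},
     free_curve f -> reduced_curve 2 q -> finite_intersection f q ->
     reduced_curve (d + 2) (f * q) /\ type_at_most (d + 2) (f * q) 2) /\
  (forall l : {mpoly R[i][3]},
     plus_one_generated d f -> line l -> ~ irreducible_component l f ->
     reduced_curve (d + 1) (f * l) /\ type_at_most (d + 1) (f * l) 2).
Proof.
have [d0 f0 fh fsq] := hf; split=> [q [m [r [[rD gen] free]]] [_ q0 qh qsq] fin|l].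
  split.
    split; first by rewrite addn_gt0 d0.
    - by rewrite mulf_neq0.
    - exact: dhomogM.
    apply: (squarefree_mul f0 q0 fsq qsq) => p pP.
    exact: finite_intersection_coprime f0 fh fin pP.
  have rB : basis_of_orthogonal (grad f) r.
    split=> // [j|u /D0E/gen[c ->]]; first by apply/D0E/rD; rewrite inE.
    by exists c; apply: eq_bigl => j; rewrite inE.
  have [k [l [u [v [[uD vD] [hu hv] kl w0]]]]] := free_syzygies d0 f0 fh fsq rB.
  have uD' : D0 f u := (D0E f u).2 uD.
  have vD' : D0 f v := (D0E f v).2 vD.
  apply: (union_type_at_most d0 f0 fh q0 qh uD' vD' hu hv w0).
  by rewrite kl; lia.
move=> [m [r [e [rmin emon]]]] t1 ll Nl; have [l0 lh] := ll.
split.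
  split; first by rewrite addn_gt0 d0.
  - by rewrite mulf_neq0.
  - exact: dhomogM.
  apply: (squarefree_mul f0 l0 fsq) => [g|p pP pf pl]; first exact: linear_form_squarefree.
  apply: Nl; split; last exact: prime_divides_linear_form pl pf.
  split=> [|a b]; first by rewrite (msize_homog l0 lh).
  exact: linear_form_irreducible.
have w0 := first_generators_independent (@D0_saturated _ f) rmin emon.
have [hr [rD _] _] := rmin.
have {}rD j : D0 f (r j) by apply: rD; rewrite inE.
apply: (union_type_at_most d0 f0 fh l0 lh (rD 0) (rD 1) (hr 0) (hr 1) w0).
move: t1; have -> : inord 0 = 0 :> 'I_m.+2 by apply: val_inj; rewrite /= inordK.
have -> : inord 1 = 1 :> 'I_m.+2 by apply: val_inj; rewrite /= inordK.
lia.
Qed.
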